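(* Let $0<s<\tfrac12$, and let $q_c=\frac{s}{1-s}$ and $\theta=1-q_c=\frac{1-2s}{1-s}$. Then there exist a closed set $E\subset\mathbb T$ of Lebesgue measure zero and a nonatomic singular probability measure $\mu$ supported on $E$ such that $$\sum_J |J|^{\theta}\Bigl(\log\frac{e}{|J|}\Bigr)^{q_c}<\infty,$$ where the sum is taken over all complementary arcs $J$ of $E$ (the connected components of $\mathbb T\setminus E$), and such that for every nonzero finite positive Borel measure $\nu$ on $\mathbb T$ with $0<\nu\le\mu$, $$S_\nu'\notin H^s.$$
   Context: $\mathbb D$ is the open unit disk in $\mathbb C$ and $\mathbb T=\partial\mathbb D$, identified with $\mathbb R/\mathbb Z$ via $x\mapsto e^{2\pi i x}$. $|J|$ denotes normalized arc length (so $|\mathbb T|=1$). ''Singular'' means singular with respect to Lebesgue measure on $\mathbb T$. For positive measures, $\nu\le\mu$ means $\nu(A)\le\mu(A)$ for all Borel sets $A$, and $0<\nu$ means $\nu$ is nonzero. For a finite positive singular measure $\sigma$ on $\mathbb T$, the associated singular inner function is $$S_\sigma(z)=\exp\Bigl(-\int_{\mathbb T}\frac{\xi+z}{\xi-z}\,d\sigma(\xi)\Bigr),\qquad z\in\mathbb D.$$ $H^s$ is the Hardy space on $\mathbb D$: holomorphic $f$ with $\sup_{0<r<1}\int_{\mathbb T}|f(r\xi)|^s\,|d\xi|<\infty$. *)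

(* Defs.v *)
From HB Require Import structures.
From mathcomp Require Import all_boot all_order all_algebra.
From mathcomp Require Import complex.
From mathcomp Require Import all_classical all_reals all_analysis.
From mathcomp Require Import measurable_realfun.

Set Implicit Arguments.
Unset Strict Implicit.
Unset Printing Implicit Defensive.

Import Order.TTheory GRing.Theory Num.Theory.
Import numFieldNormedType.Exports.

Local Open Scope classical_set_scope.
Local Open Scope ring_scope.
Local Open Scope complex_scope.

(* R[i] gets its topology and its normed space structure through R[i]^o. *)

Definition unit_disk (R : realType) : set R[i]^o := [set z | `|z| < 1].

Definition unit_circle (R : realType) : set R[i]^o := [set z | `|z| = 1].

Lemma unit_circle1 (R : realType) : (1 : R[i]^o) \in @unit_circle R.
Proof. by rewrite inE /unit_circle/= normr1. Qed.

(* The circle with the topology induced by R[i] and its Borel sigma-algebra. *)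
Definition circle (R : realType) : Type := set_type (@unit_circle R).

HB.instance Definition _ (R : realType) :=
  Topological.copy (circle R) (set_type (@unit_circle R)).
HB.instance Definition _ (R : realType) :=
  isPointed.Build (circle R) (exist _ 1 (unit_circle1 R)).
HB.instance Definition _ (R : realType) :=
  Measurable.copy (circle R) (g_sigma_algebraType (@open (circle R))).

Definition circle_val (R : realType) (xi : circle R) : R[i]^o := set_val xi.

Definition cexp (R : realType) (z : R[i]) : R[i] :=
  (expR (complex.Re z) * cos (complex.Im z))
  +i* (expR (complex.Re z) * sin (complex.Im z)).

Lemma cexp_circle (R : realType) (x : R) :
  (cexp (0 +i* (2 * pi * x)) : R[i]^o) \in @unit_circle R.
Proof.
by rewrite inE /unit_circle/= normc_def/= expR0 !mul1r cos2Dsin2 sqrtr1.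
Qed.

(* x |-> exp (2 pi i x), identifying R/Z with the circle *)
Definition circle_exp (R : realType) (x : R) : circle R :=
  exist _ (cexp (0 +i* (2 * pi * x))) (cexp_circle x).

Lemma continuous_circle_exp (R : realType) : continuous (@circle_exp R).
Proof.
apply: continuous_comp_initial => x.
apply/cvgrPdist_lt => /= -[e e'].
rewrite ltcE/= => /andP[/eqP ->{e'} e0].
have cc : (fun y : R => cos (2 * pi * y)) @ x --> cos (2 * pi * x).
  apply: continuous_comp; last exact: continuous_cos.
  by apply: cvgMr; exact: cvg_id.
have cs : (fun y : R => sin (2 * pi * y)) @ x --> sin (2 * pi * x).
  apply: continuous_comp; last exact: continuous_sin.
  by apply: cvgMr; exact: cvg_id.
have e20 : 0 < e / 2 by rewrite divr_gt0.
move/cvgrPdist_lt : cc => /(_ _ e20) cc.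
move/cvgrPdist_lt : cs => /(_ _ e20) cs.
near=> y.
rewrite /circle_exp /cexp set_valE/= normc_def/= expR0 !mul1r ltcR.
have : `|sin (2 * pi * x) - sin (2 * pi * y)| < e / 2 by near: y; exact: cs.
have : `|cos (2 * pi * x) - cos (2 * pi * y)| < e / 2 by near: y; exact: cc.
move: (_ - cos _) (_ - sin _) => a b ha hb.
have : Num.sqrt (a ^+ 2 + b ^+ 2) <= `|a| + `|b|.
  rewrite -(ler_pXn2r (n := 2)) ?nnegrE ?sqrtr_ge0 ?addr_ge0//.
  rewrite sqr_sqrtr ?addr_ge0 ?sqr_ge0// sqrrD !real_normK ?num_real//.
  by rewrite lerD2r lerDl mulrn_wge0// mulr_ge0.
move=> /le_lt_trans; apply.
by rewrite [ltRHS](splitr e) ltrD.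
Unshelve. all: by end_near. Qed.

Lemma measurable_circle_exp (R : realType) :
  measurable_fun [set: measurableTypeR R] (@circle_exp R).
Proof.
apply: (@measurability _ _ _ _ _ _ (@open (circle R))) => //.
move=> _ [A oA <-]; rewrite setTI; apply: open_measurable.
by move/continuousP : (@continuous_circle_exp R); exact.
Qed.

(* normalized arc length *)
Definition arclength (R : realType) : set (circle R) -> \bar R :=
  pushforward
    (mrestr (@lebesgue_measure R) (measurable_itv `[(0 : R), 1[))
    (@circle_exp R).

Lemma arclength0 (R : realType) : arclength (@set0 (circle R)) = 0%E.
Proof. by rewrite /arclength /pushforward preimage_set0 measure0. Qed.

Lemma arclength_ge0 (R : realType) (A : set (circle R)) :
  (0 <= arclength A)%E.
Proof. by rewrite /arclength /pushforward; exact: measure_ge0. Qed.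

Lemma arclength_sigma_additive (R : realType) :
  semi_sigma_additive (@arclength R).
Proof.
move=> F mF tF mUF; rewrite /arclength /pushforward preimage_bigcup.
have mpre A : measurable A -> measurable (@circle_exp R @^-1` A).
  by move=> mA; rewrite -[X in measurable X]setTI; exact: measurable_circle_exp.
apply: measure_semi_sigma_additive.
- by move=> n; exact: mpre.
- apply/trivIsetP => /= i j _ _ ij; rewrite -preimage_setI.
  by move/trivIsetP : tF => /(_ _ _ _ _ ij) ->//; rewrite preimage_set0.
- by rewrite -preimage_bigcup; exact: mpre.
Qed.

HB.instance Definition _ (R : realType) := isMeasure.Build _ _ _
  (@arclength R) (@arclength0 R) (@arclength_ge0 R) (@arclength_sigma_additive R).

Lemma arclengthT (R : realType) : arclength [set: circle R] = 1%E.
Proof.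
rewrite /arclength /pushforward preimage_setT /mrestr setTI.
by rewrite lebesgue_measure_itv/= lte_fin ltr01 oppr0 adde0.
Qed.

HB.instance Definition _ (R : realType) :=
  Measure_isProbability.Build _ _ _ (@arclength R) (@arclengthT R).

Definition singular (R : realType) (nu : set (circle R) -> \bar R) : Prop :=
  exists A, [/\ measurable A, arclength A = 0%E & nu (~` A) = 0%E].

(* every measurable set of positive measure can be split: there are no atoms *)
Definition nonatomic d (T : measurableType d) (R : realType)
    (mu : set T -> \bar R) : Prop :=
  forall A, measurable A -> (0 < mu A)%E ->
  exists B, [/\ measurable B, B `<=` A, (0 < mu B)%E & (mu B < mu A)%E].

Definition components (T : topologicalType) (A : set T) : set (set T) :=
  [set connected_component A x | x in A].

Definition cintegral d (T : measurableType d) (R : realType)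
    (mu : {measure set T -> \bar R}) (f : T -> R[i]) : R[i] :=
  Rintegral mu [set: T] (fun x => complex.Re (f x))
  +i* Rintegral mu [set: T] (fun x => complex.Im (f x)).

Definition singular_inner (R : realType)
    (sigma : {measure set (circle R) -> \bar R}) (z : R[i]^o) : R[i]^o :=
  cexp (- cintegral sigma
            (fun xi => (circle_val xi + z) / (circle_val xi - z))).

Definition holomorphic_on (R : realType) (D : set R[i]^o)
    (f : R[i]^o -> R[i]^o) : Prop :=
  forall z, D z -> derivable f z 1.

(* Only finiteness of the means matters, so |d xi| is taken normalized. *)
Definition hardy (R : realType) (s : R) : set (R[i]^o -> R[i]^o) :=
  [set f | holomorphic_on (@unit_disk R) f /\
    (ereal_sup [set \int[@arclength R]_xi
                      (Normc.normc (f (r%:C * circle_val xi)%R) `^ s)%:E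
               | r in [set r : R | (0 < r < 1)%R]] < +oo)%E].

(* Main.v *)
Require Import Defs.
From HB Require Import structures.
From mathcomp Require Import all_boot all_order all_algebra.
From mathcomp Require Import complex.
From mathcomp Require Import all_classical all_reals all_analysis.
From mathcomp Require Import measurable_realfun.
From mathcomp Require Import zify ring lra.

(** The set is a Cantor set whose dimension theta is critical for the problem,
    tuned at the logarithmic scale, and the measure gives mass 2 ^ - n to each of
    its 2 ^ n pieces of generation n.

    Let the 2 ^ n gaps of generation n have length g n, and put
    a n = 2 ^ n (g n) ^ theta. If the sequence 2 ^ n g n decays geometrically, a
    piece of generation n has a length comparable with g n. As log (e / g n) is
    comparable with n, the sum over the complementary arcs converges as soon as
    the sum of a n * n ^ q does.

    Let 0 < nu <= mu. At a point zeta in the middle half of a gap of generation n,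
    the function S of nu has unimodular radial limit and
    |S' (zeta)| = 2 * int |xi - zeta| ^ -2 d nu (xi), which is at least a constant
    times nu (P) / (g n) ^ 2 where P is the piece split by the gap. Integrating the
    power s over the gaps of generation n gives at least a constant times
    (g n) ^ (1 - 2 s) times the sum of nu (P) ^ s over these pieces. Because
    nu (P) <= mu (P) = 2 ^ - n, one has nu (P) ^ s >= 2 ^ (n (1 - s)) nu (P), so that
    the sum is at least 2 ^ (n (1 - s)) times the total mass of nu, however nu is
    distributed. The contribution of generation n is thus at least a constant
    times (a n) ^ (1 - s).

    It remains to find a sequence for which the sum of a n * n ^ q converges and
    that of (a n) ^ (1 - s) diverges. By Hoelder's inequality this is just
    possible: (a n) ^ (1 - s) = 1 / (n log n) will do ([exists_gap_lengths]).

    The set is the complement of the gaps opened by the jump function [jump], a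
    discrete distribution function with an atom at every dyadic point, and mu is
    the image of Lebesgue measure under it ([exists_cantor_measure],
    [components_bigcup], [esum_components]). Instead of radial limits, the
    argument uses a bound for S' at r zeta which is uniform over finitely many
    gaps when r is close to 1 ([derive1_singular_inner], [derive1_lower_bound],
    [exists_radius]); integrating it over more and more generations shows that
    the means are unbounded ([derive1_not_hardy]). *)

Set Implicit Arguments.
Unset Strict Implicit.
Unset Printing Implicit Defensive.

Import Order.TTheory GRing.Theory Num.Theory.
Import numFieldNormedType.Exports.

Local Open Scope classical_set_scope.
Local Open Scope ring_scope.
Local Open Scope complex_scope.

(** * The breadth-first binary tree and the gap lengths *)

(** Nodes of the infinite binary tree are listed breadth first, so that k.+1 is
    the heap label of node k and its generation is the integer part of the
    binary logarithm of k.+1. *)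
Definition lev (k : nat) : nat := trunc_log 2 k.+1.

Lemma levP (k : nat) : (2 ^ lev k <= k.+1 < 2 ^ (lev k).+1)%N.
Proof. exact: trunc_log_bounds. Qed.

Lemma lev_eq (n k : nat) : (2 ^ n <= k.+1 < 2 ^ n.+1)%N -> lev k = n.
Proof. exact: trunc_log_eq. Qed.

Lemma leq_lev (m n : nat) : (m <= n)%N -> (lev m <= lev n)%N.
Proof. by move=> mn; exact: leq_trunc_log. Qed.

Lemma lev_le (n : nat) : (lev n <= n)%N.
Proof.
have /andP[h _] := levP n.
have := ltn_expl (lev n) (isT : (1 < 2)%N); lia.
Qed.

Lemma pred_exp2S (N : nat) : (2 ^ N.+1).-1 = ((2 ^ N).-1 + 2 ^ N)%N.
Proof. by have := expn_gt0 2 N; rewrite expnS; lia. Qed.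

Lemma leq_pred_exp2 (n : nat) : (n <= (2 ^ n).-1)%N.
Proof. by have := ltn_expl n (isT : (1 < 2)%N); lia. Qed.

Lemma lev_block (n k : nat) :
  ((2 ^ n).-1 <= k < (2 ^ n.+1).-1)%N = (lev k == n).
Proof.
have n0 : (0 < 2 ^ n)%N by rewrite expn_gt0.
have n1 : (0 < 2 ^ n.+1)%N by rewrite expn_gt0.
apply/idP/eqP => [h|<-]; first by apply: lev_eq; lia.
by have := levP k; lia.
Qed.

Lemma lev_lt (n k : nat) : (k < (2 ^ n).-1)%N -> (lev k < n)%N.
Proof.
move=> kn; rewrite -(@ltn_exp2l 2)//; have /andP[h _] := levP k.
by apply: leq_ltn_trans h _; lia.
Qed.

(** There are 2 ^ n nodes of generation n. The same identity is Cauchy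
    condensation, since lev k is comparable with log k: besides the sums over the
    tree it evaluates the logarithmic series below. *)
Lemma sum_lev (V : nmodType) (F : nat -> V) (N : nat) :
  \sum_(0 <= k < (2 ^ N).-1) F (lev k) = \sum_(0 <= n < N) F n *+ 2 ^ n.
Proof.
elim: N => [|N IH]; first by rewrite !big_geq.
rewrite big_nat_recr//= -IH pred_exp2S.
rewrite (@big_cat_nat _ _ _ (2 ^ N).-1) //=; last exact: leq_addr.
congr (_ + _); rewrite -[X in _ *+ X](addKn (2 ^ N).-1) -sumr_const_nat.
by apply: eq_big_nat => k; rewrite -pred_exp2S lev_block => /eqP ->.
Qed.

Section GapLengths.
Variable R : realType.
Implicit Types (x y : R) (n k : nat).

(** Comparable with 1 / (n log n), as lev n and lev (lev n) stand for log n and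
    log log n. *)
Definition hweight n : R := 2 `^ (- (lev n + lev (lev n))%:R).

Lemma hweight_gt0 n : 0 < hweight n.
Proof. exact: powR_gt0. Qed.

Lemma hweight_decr m n : (m <= n)%N -> hweight n <= hweight m.
Proof.
move=> mn; apply: ler_powR; first by lra.
by rewrite lerN2 ler_nat leq_add ?leq_lev.
Qed.

Lemma pow2n n : (2 : R) ^+ n = 2 `^ n%:R.
Proof. by rewrite powR_mulrn//; lra. Qed.

Lemma pow2D x y : (2 : R) `^ (x + y) = 2 `^ x * 2 `^ y.
Proof. by rewrite powRD// pnatr_eq0 implybT. Qed.

(** Two condensations turn the series into a sum of ones, whence the doubly
    exponential range: this is the divergence of the sum of 1 / (n log n). *)
Lemma sum_hweight J :
  \sum_(0 <= n < (2 ^ (2 ^ J).-1).-1) hweight n = J%:R.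
Proof.
pose F k : R := 2 `^ (- (k + lev k)%:R).
rewrite (sum_lev F); pose G j : R := 2 `^ (- j%:R).
rewrite (eq_bigr (fun k => G (lev k))); last first.
  move=> k _; rewrite /F /G -[LHS]mulr_natr natrX pow2n -pow2D natrD; congr (_ `^ _); ring.
rewrite sum_lev (eq_bigr (fun=> 1)); last first.
  move=> k _; rewrite /G -[LHS]mulr_natr natrX pow2n -pow2D addNr powRr0//.
by rewrite sumr_const_nat subn0.
Qed.

Lemma sum_geometric_le (x : R) n : 0 <= x -> x < 1 ->
  \sum_(0 <= k < n) x ^+ k <= (1 - x)^-1.
Proof.
move=> x0 x1; rewrite -[leRHS]mul1r ler_pdivlMr ?subr_gt0//.
rewrite mulrC big_mkord -opprB mulNr -subrX1 opprB.
by rewrite gerBl exprn_ge0.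
Qed.

(** For kappa = 1 / (1 - 2 s) this is, before normalisation, the gap length l of
    generation n at which l ^ (1 - 2 s) * 2 ^ (n (1 - s)) equals hweight n. *)
Definition profile (kappa : R) n : R :=
  hweight n `^ kappa * (2 `^ (- ((kappa + 1) / 2))) ^+ n.

Lemma profile_gt0 kappa n : 0 < profile kappa n.
Proof. by rewrite mulr_gt0 ?powR_gt0 ?exprn_gt0 ?powR_gt0 ?hweight_gt0. Qed.

Section Profile.
Variable kappa : R.
Hypothesis kappa_gt1 : 1 < kappa.

Let kappa_ge0 : 0 <= kappa. Proof. by have := kappa_gt1; lra. Qed.

Definition ratio : R := 2 `^ ((1 - kappa) / 2).

Lemma ratio_gt0 : 0 < ratio. Proof. exact: powR_gt0. Qed.

Lemma ratio_lt1 : ratio < 1.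
Proof.
rewrite /ratio /powR gt_eqF// expR_lt1.
have ln2 : 0 < ln (2 : R) by rewrite ln_gt0//; lra.
rewrite nmulr_rlt0// ltr_pdivrMr// mul0r subr_lt0 kappa_gt1//.
Qed.

Lemma mass_profileE n : 2 ^+ n * profile kappa n = hweight n `^ kappa * ratio ^+ n.
Proof.
rewrite /profile mulrCA; congr (_ * _); rewrite -exprMn; congr (_ ^+ _).
rewrite -[X in X * _]powRr1// -pow2D /ratio; congr (_ `^ _); by field.
Qed.

Lemma mass_profile_decay m n : (n <= m)%N ->
  2 ^+ m * profile kappa m <= 2 ^+ n * profile kappa n * ratio ^+ (m - n).
Proof.
move=> nm; rewrite (mass_profileE m) (mass_profileE n).
rewrite -[leRHS]mulrA -exprD (subnKC nm).
apply: ler_wpM2r; first by rewrite exprn_ge0// ltW// ratio_gt0.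
by rewrite ge0_ler_powR ?nnegrE ?(ltW (hweight_gt0 _)) ?hweight_decr.
Qed.

(** The generations from n on have together a length comparable with that of
    generation n alone. This makes a piece of the Cantor set comparable with its
    central gap. *)
Lemma mass_profile_tail n N :
  \sum_(n <= m < N) 2 ^+ m * profile kappa m <=
  (1 - ratio)^-1 * (2 ^+ n * profile kappa n).
Proof.
apply: (@le_trans _ _ (\sum_(n <= m < N) 2 ^+ n * profile kappa n * ratio ^+ (m - n))).
  apply: ler_sum_nat => m /andP[nm _]; exact: mass_profile_decay.
rewrite -mulr_sumr mulrC ler_wpM2r//.
  by rewrite mulr_ge0 ?exprn_ge0// ltW// profile_gt0.
rewrite -{1}[n]add0n big_addn.
under eq_bigr do rewrite addnK.
exact: sum_geometric_le (ltW ratio_gt0) ratio_lt1.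
Qed.

Lemma profile_decr m n : (m <= n)%N -> profile kappa n <= profile kappa m.
Proof.
move=> mn; apply: ler_pM.
- exact: powR_ge0.
- by rewrite exprn_ge0// powR_ge0.
- by rewrite ge0_ler_powR ?nnegrE ?(ltW (hweight_gt0 _)) ?hweight_decr.
- rewrite ler_wiXn2l// ?powR_ge0// -[leRHS](powRr0 (2 : R)) ler_powR//; have := kappa_ge0; lra.
Qed.

Lemma cvg_mass_profile : cvgn (series (fun n => 2 ^+ n * profile kappa n)).
Proof.
apply: nondecreasing_is_cvgn.
  by apply: nondecreasing_series => n _ _; rewrite mulr_ge0 ?exprn_ge0 ?(ltW (profile_gt0 _ _)).
exists ((1 - ratio)^-1 * (2 ^+ 0 * profile kappa 0)) => _ [n _ <-].
exact: mass_profile_tail.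
Qed.

Definition total_mass : R := limn (series (fun n => 2 ^+ n * profile kappa n)).

Lemma total_mass_gt0 : 0 < total_mass.
Proof.
apply: (@lt_le_trans _ _ (series (fun n => 2 ^+ n * profile kappa n) 1)).
  by rewrite /series/= big_nat1 mul1r profile_gt0.
apply: nondecreasing_cvgn_le; last exact: cvg_mass_profile.
by apply: nondecreasing_series => n _ _; rewrite mulr_ge0 ?exprn_ge0 ?(ltW (profile_gt0 _ _)).
Qed.

Definition gap n : R := profile kappa n / total_mass.

Lemma gap_gt0 n : 0 < gap n.
Proof. by rewrite divr_gt0 ?profile_gt0 ?total_mass_gt0. Qed.

Lemma gap_decr m n : (m <= n)%N -> gap n <= gap m.
Proof.
move=> mn; rewrite ler_wpM2r ?profile_decr// invr_ge0 ltW//.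
exact: total_mass_gt0.
Qed.

Lemma cvg_mass_gap : series (fun n => 2 ^+ n * gap n) @ \oo --> (1 : R).
Proof.
have -> : series (fun n => 2 ^+ n * gap n) =
    (fun n => series (fun n => 2 ^+ n * profile kappa n) n / total_mass).
  apply/funext => n; rewrite /series/= mulr_suml; apply: eq_bigr => i _.
  by rewrite /gap mulrA.
rewrite -[X in _ --> X](mulfV (lt0r_neq0 total_mass_gt0)); apply: cvgMl.
exact: cvg_mass_profile.
Qed.

Lemma mass_gap_tail n N :
  \sum_(n <= m < N) 2 ^+ m * gap m <= (1 - ratio)^-1 * (2 ^+ n * gap n).
Proof.
rewrite /gap; under eq_bigr do rewrite mulrA.
rewrite -mulr_suml [X in _ <= _ * X]mulrA [leRHS]mulrA.
by rewrite ler_wpM2r ?mass_profile_tail// invr_ge0 ltW// total_mass_gt0.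
Qed.

Lemma mass_gap_le1 n : 2 ^+ n * gap n <= 1.
Proof.
have nd : nondecreasing_seq (series (fun n => 2 ^+ n * gap n)).
  by apply: nondecreasing_series => k _ _; rewrite mulr_ge0 ?exprn_ge0 ?(ltW (gap_gt0 _)).
have cv := cvg_mass_gap.
have lim1 : limn (series (fun n => 2 ^+ n * gap n)) = 1.
  exact/cvg_lim.
rewrite -[leRHS]lim1; apply: le_trans (nondecreasing_cvgn_le nd _ n.+1); last first.
  by apply/cvg_ex; exists 1.
rewrite /series/= big_nat_recr//= lerDr sumr_ge0// => i _.
by rewrite mulr_ge0 ?exprn_ge0 ?(ltW (gap_gt0 _)).
Qed.

End Profile.

(** In terms of a n = 2 ^ n * g n `^ theta, the last two conditions say that the
    sum of a n * n ^ q converges, as log (e / g n) is comparable with n, and that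
    the sum of a n ^ (1 - s) diverges. By Hoelder's inequality this is borderline:
    the powers a n = n ^ (- 1 / (1 - s)) make both series diverge like the harmonic
    one. The choice a n ^ (1 - s) = hweight n separates them, because it turns the
    first series into that of 1 / (n (log n) ^ p) with p = 1 / (1 - s) > 1. *)
Lemma exists_gap_lengths (s : R) : 0 < s -> s < 1 / 2 ->
  let q := s / (1 - s) in
  let theta := 1 - q in
  exists g : nat -> R, [/\ forall n, 0 < g n,
    {homo g : m n / (m <= n)%N >-> n <= m},
    series (fun n => 2 ^+ n * g n) @ \oo --> (1 : R) &
    exists2 C : R, 0 < C &
      forall n N, \sum_(n <= m < N) 2 ^+ m * g m <= C * (2 ^+ n * g n)] /\
    (exists C : R, forall N, \sum_(0 <= n < N)
        2 ^+ n * (g n `^ theta * ln (expR 1 / g n) `^ q) <= C) /\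
    (forall K : R, exists N, K <= \sum_(0 <= n < N)
        g n `^ (1 - 2 * s) * (2 ^+ n) `^ (1 - s)).
Proof.
move=> s0 s12 q theta.
have s1 : 0 < 1 - s by lra.
have s2 : 0 < 1 - 2 * s by lra.
have s1n0 : 1 - s != 0 by rewrite gt_eqF.
have s2n0 : 1 - 2 * s != 0 by rewrite gt_eqF.
pose p : R := (1 - s)^-1.
have p1 : 1 < p by rewrite invf_gt1//; lra.
pose kappa : R := (1 - 2 * s)^-1.
have kappa1 : 1 < kappa by rewrite invf_gt1//; lra.
have q0 : 0 < q by rewrite divr_gt0.
have pqE : p = 1 + q by rewrite /p /q; field.
have theta0 : 0 < theta.
  by rewrite (_ : theta = (1 - 2 * s) / (1 - s)) ?divr_gt0// /theta /q; field.
pose Z := total_mass kappa.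
have Z0 : 0 < Z := total_mass_gt0 kappa1.
have Zp x : 0 < Z `^ x by exact: powR_gt0.
pose g := gap kappa.
have powg x n : g n `^ x = Z `^ (- x) *
    (hweight n `^ (kappa * x) * 2 `^ (- ((kappa + 1) / 2 * x) * n%:R)).
  rewrite /g /gap powRM ?invr_ge0 ?(ltW Z0) ?(ltW (profile_gt0 _ _))//.
  rewrite mulrC -powR_inv1 ?(ltW Z0)// -powRrM mulN1r; congr (_ * _).
  rewrite /profile powRM ?exprn_ge0 ?powR_ge0// -powRrM; congr (_ * _).
  by rewrite -powR_mulrn ?powR_ge0// -!powRrM; congr (_ `^ _); ring.
exists g; split; [split|split].
- by move=> n; exact: gap_gt0.
- by move=> m n; exact: gap_decr.
- exact: cvg_mass_gap.
- exists ((1 - ratio kappa)^-1); last exact: mass_gap_tail.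
  by rewrite invr_gt0 subr_gt0 ratio_lt1.
- have hw x n : hweight n `^ x = 2 `^ (- (lev n + lev (lev n))%:R * x).
    by rewrite /hweight -powRrM.
  pose A := 1 + `|ln Z| + 4 * kappa.
  have A0 : 0 <= A by rewrite /A; have := normr_ge0 (ln Z); lra.
  have logg n : ln (expR 1 / g n) <= A * n.+1%:R.
    have gE : g n = Z `^ (- 1) * (hweight n `^ kappa * 2 `^ (- ((kappa + 1) / 2) * n%:R)).
      by rewrite -[LHS]powRr1 ?(ltW (gap_gt0 _ _))// powg !mulr1.
    rewrite ln_div ?posrE ?expR_gt0 ?gap_gt0// expRK gE.
    rewrite !lnM ?posrE ?mulr_gt0 ?powR_gt0 ?hweight_gt0// !ln_powR.
    have l2 : 0 <= ln (2 : R) <= 1.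
      rewrite ln_ge0 ?ler1n//=.
      have := @le_ln1Dx R 1; rewrite (_ : 1 + 1 = 2 :> R)//; apply; lra.
    have := lev_le n; have := lev_le (lev n).
    rewrite -!(ler_nat R) => h1 h2.
    have := ler_norm (ln Z).
    have n0 : 0 <= n%:R :> R by [].
    have l0 : 0 <= (lev (lev n))%:R :> R by [].
    have l1 : 0 <= (lev n)%:R :> R by [].
    have nZ : 0 <= `|ln Z| * n%:R by rewrite mulr_ge0.
    rewrite /A -(natr1 n) natrD; move: (ln Z) (`|ln Z|) nZ => lz az nZ h3.
    have [l20 l21] := andP l2.
    have e1 : ((lev n)%:R + (lev (lev n))%:R) * ln 2 <= 2 * n%:R :> R.
      rewrite (@le_trans _ _ (2 * n%:R * ln 2))// ?ler_wpM2r//; first lra.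
      by rewrite ler_piMr//; lra.
    have e2 : n%:R * ln 2 <= n%:R :> R by rewrite ler_piMr.
    have k0 : 0 <= kappa by lra.
    have e3 : kappa * (((lev n)%:R + (lev (lev n))%:R) * ln 2) <= kappa * (2 * n%:R).
      by rewrite ler_wpM2l.
    have e4 : kappa * (n%:R * ln 2) <= kappa * n%:R by rewrite ler_wpM2l.
    have kn : n%:R <= kappa * n%:R by rewrite ler_peMl// ltW.
    lra.
  pose r : R := 2 `^ (1 - p).
  have r0 : 0 <= r by exact: powR_ge0.
  have r1 : r < 1.
    rewrite /r /powR gt_eqF// expR_lt1 nmulr_rlt0 ?ln_gt0 ?ltr1n//.
    by rewrite subr_lt0.
  pose M : R := Z `^ (- theta) * A `^ q * 2 `^ q.
  have M0 : 0 <= M by rewrite !mulr_ge0 ?powR_ge0.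
  (* the factor (n + 1) ^ q, comparable with 2 ^ (q * lev n), cancels all of
     2 ^ (- p * lev n) but 2 ^ (- lev n), as p = 1 + q *)
  pose G k : R := 2 `^ (- (lev k)%:R - p * (lev (lev k))%:R).
  have termle n : 2 ^+ n * (g n `^ theta * ln (expR 1 / g n) `^ q) <= M * G n.
    have ktE : kappa * theta = p by rewrite /kappa /theta /q /p; field; apply/andP.
    have ktE' : (kappa + 1) / 2 * theta = 1.
      by rewrite /kappa /theta /q; field; apply/andP.
    have -> : 2 ^+ n * (g n `^ theta * ln (expR 1 / g n) `^ q) = Z `^ (- theta) *
        2 `^ (- (lev n + lev (lev n))%:R * p) * ln (expR 1 / g n) `^ q.
      rewrite powg hw pow2n ktE ktE' mulrA; congr (_ * _).
      rewrite mulrCA; congr (_ * _); rewrite mulrCA -pow2D.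
      by rewrite mulN1r subrr powRr0 mulr1.
    have lng0 : 0 <= ln (expR 1 / g n).
      rewrite ln_ge0// ler_pdivlMr ?gap_gt0// mul1r.
      apply: (@le_trans _ _ 1); last by rewrite -expR0 ler_expR.
      apply: le_trans (mass_gap_le1 kappa1 n).
      by rewrite ler_peMl ?(ltW (gap_gt0 _ _))// exprn_ege1// ler1n.
    have lnq : ln (expR 1 / g n) `^ q <= A `^ q * (2 `^ q * 2 `^ ((lev n)%:R * q)).
      have h : ln (expR 1 / g n) <= A * 2 ^+ (lev n).+1.
        apply: (le_trans (logg n)); rewrite ler_wpM2l// -natrX ler_nat.
        by have /andP[_ /ltnW] := levP n.
      apply: (le_trans (ge0_ler_powR (ltW q0) _ _ h)).
      - by rewrite nnegrE.
      - by rewrite nnegrE mulr_ge0// exprn_ge0.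
      rewrite powRM ?exprn_ge0// exprS powRM ?exprn_ge0//.
      by rewrite pow2n -powRrM.
    apply: (@le_trans _ _ (Z `^ (- theta) * 2 `^ (- (lev n + lev (lev n))%:R * p) *
       (A `^ q * (2 `^ q * 2 `^ ((lev n)%:R * q))))).
      by rewrite ler_wpM2l// mulr_ge0 ?powR_ge0.
    rewrite /M /G; have -> : - (lev n)%:R - p * (lev (lev n))%:R =
       - (lev n + lev (lev n))%:R * p + (lev n)%:R * q.
      by rewrite natrD pqE; ring.
    by rewrite pow2D le_eqVlt; apply/orP; left; apply/eqP; ring.
  exists (M * (1 - r)^-1) => N.
  apply: (@le_trans _ _ (\sum_(0 <= n < N) M * G n)).
    by apply: ler_sum_nat => n _; exact: termle.
  rewrite -mulr_sumr ler_wpM2l//.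
  have monoG m n (F : nat -> R) : (forall k, 0 <= F k) -> (m <= n)%N ->
      \sum_(0 <= k < m) F k <= \sum_(0 <= k < n) F k.
    by move=> F0 mn; rewrite [leRHS](big_cat_nat (n := m))//= lerDl sumr_ge0.
  have G0 k : 0 <= G k by exact: powR_ge0.
  apply: (le_trans (monoG _ _ G G0 (leq_pred_exp2 N))).
  (* condensed once, the series has general term 2 ^ (- p * lev k); condensed
     twice, it is geometric of ratio 2 ^ (1 - p) *)
  pose G1 k : R := 2 `^ (- k%:R - p * (lev k)%:R).
  rewrite (sum_lev G1).
  pose G2 k : R := 2 `^ (- (p * k%:R)).
  rewrite (eq_bigr (fun k => G2 (lev k))); last first.
    move=> k _; rewrite /G1 /G2 -[LHS]mulr_natr natrX pow2n -pow2D.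
    by congr (_ `^ _); ring.
  apply: (le_trans (monoG _ _ _ _ (leq_pred_exp2 N))) => [k|]; first exact: powR_ge0.
  rewrite (sum_lev G2) (eq_bigr (fun k => r ^+ k)); last first.
    move=> k _; rewrite /G2 /r -[LHS]mulr_natr natrX pow2n -pow2D.
    by rewrite -powR_mulrn ?powR_ge0// -powRrM; congr (_ `^ _); ring.
  exact: sum_geometric_le.
- move=> K; pose B : R := Z `^ (- (1 - 2 * s)).
  pose J := (Num.truncn (`|K| / B)).+1.
  exists (2 ^ (2 ^ J).-1).-1.
  rewrite (eq_bigr (fun n => B * hweight n)); last first.
    move=> n _; rewrite powg pow2n -powRrM -[LHS]mulrA; congr (_ * _).
    have -> : kappa * (1 - 2 * s) = 1 by rewrite /kappa mulVf.
    rewrite powRr1 ?(ltW (hweight_gt0 _))// -[RHS]mulr1 -mulrA; congr (_ * _).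
    rewrite -pow2D; have -> : (kappa + 1) / 2 * (1 - 2 * s) = 1 - s.
      by rewrite /kappa; field.
    by rewrite [n%:R * _]mulrC mulNr addNr powRr0.
  rewrite -mulr_sumr sum_hweight mulrC -ler_pdivrMr; last exact: Zp.
  apply: (@le_trans _ _ (`|K| / B)).
    by rewrite ler_wpM2r ?ler_norm// invr_ge0 ltW// Zp.
  by rewrite ltW// truncnS_gt.
Qed.

End GapLengths.

(** * Dyadic nodes and cells *)

Lemma sum_blocks (V : nmodType) (F : nat -> V) (N : nat) :
  \sum_(0 <= k < (2 ^ N).-1) F k =
  \sum_(0 <= n < N) \sum_((2 ^ n).-1 <= k < (2 ^ n.+1).-1) F k.
Proof.
elim: N => [|N IH]; first by rewrite !big_geq.
rewrite big_nat_recr//= -IH (@big_cat_nat _ _ _ (2 ^ N).-1) //=.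
by rewrite pred_exp2S leq_addr.
Qed.

(** The nonzero terms have at most c indices. *)
Lemma sum_indicator_le (R : realDomainType) (x : R) (P : pred nat) (a c A B : nat) :
  0 <= x -> (forall j, P j -> (a <= j < a + c)%N) ->
  \sum_(A <= j < B) x * (P j)%:R <= x *+ c.
Proof.
move=> x0 Pac; rewrite (eq_bigr (fun j => if P j then x else 0)); last first.
  by move=> j _; case: (P j); rewrite ?mulr1 ?mulr0.
rewrite -big_mkcond -big_filter big_const_seq iter_addr_0 count_predT.
rewrite ler_wpMn2l// -[leqRHS](size_iota a); apply: uniq_leq_size.
  by rewrite filter_uniq// iota_uniq.
by move=> j; rewrite mem_filter mem_iota => /andP[/Pac].
Qed.

(** In the next three lemmas a power of 2, written a, is cancelled between the
    denominators of a node and of an end point of a cell; b is the ratio of the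
    other factors. The inequalities between the odd numerator 2 j + 3 and even
    numbers then become inequalities between heap labels. *)
Lemma descendant_ge (a b k j : nat) : (0 < a)%N ->
  (k.+1 * (a * (2 * b)) < (j.*2 + 3) * a)%N -> (k.+1 * b <= j.+1)%N.
Proof. move=> a0; rewrite mulnCA [X in (X < _)%N]mulnC ltn_pmul2r//; lia. Qed.

Lemma descendant_lt (a b k j : nat) : (0 < a)%N ->
  ((j.*2 + 3) * a < k.+2 * (a * (2 * b)))%N -> (j.+1 < k.+1 * b + b)%N.
Proof. move=> a0; rewrite mulnCA [X in (_ < X)%N]mulnC ltn_pmul2r//; lia. Qed.

Lemma no_shallow_descendant (a b k j : nat) : (0 < a)%N ->
  (k.+1 * a < (j.*2 + 3) * (a * b))%N -> ((j.*2 + 3) * (a * b) < k.+2 * a)%N -> False.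
Proof.
rewrite (mulnC a b) mulnA => a0; rewrite !ltn_pmul2r//; lia.
Qed.

Section Dyadic.
Variable R : realType.
Implicit Types (x y : R) (n k : nat).

(** The midpoint of the dyadic interval from cell_l k to cell_r k, which belongs
    to node k. Heap labels of generation n run from 2 ^ n to 2 ^ n.+1 - 1, which is
    why 1 is subtracted. *)
Definition dyad k : R := (k.*2 + 3)%:R / 2 ^+ (lev k).+1 - 1.
Definition cell_l k : R := k.+1%:R / 2 ^+ lev k - 1.
Definition cell_r k : R := k.+2%:R / 2 ^+ lev k - 1.

Let exp2_gt0 n : 0 < (2 : R) ^+ n. Proof. by rewrite exprn_gt0. Qed.

Lemma cell_l_ge0 k : 0 <= cell_l k.
Proof.
rewrite subr_ge0 ler_pdivlMr// mul1r -natrX ler_nat.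
by have /andP[] := levP k.
Qed.

Lemma cell_r_le1 k : cell_r k <= 1.
Proof.
rewrite lerBlDr ler_pdivrMr// -[1 + 1]/(2%:R) -exprS -natrX ler_nat.
by have /andP[_ ] := levP k.
Qed.

Lemma cell_size k : cell_r k - cell_l k = (2 ^+ lev k)^-1.
Proof. by rewrite /cell_r /cell_l -(natr1 k.+1); field; rewrite gt_eqF. Qed.

Lemma cell_l_dyad k : cell_l k < dyad k.
Proof.
rewrite /cell_l /dyad ltrD2r exprS invfM mulrA ltr_pM2r ?invr_gt0//.
rewrite ltr_pdivlMr// mulr_natr -mulrnA ltr_nat; lia.
Qed.

Lemma dyad_cell_r k : dyad k < cell_r k.
Proof.
rewrite /cell_r /dyad ltrD2r exprS invfM mulrA ltr_pM2r ?invr_gt0//.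
rewrite ltr_pdivrMr// mulr_natr -mulrnA ltr_nat; lia.
Qed.

(** A dyadic rational determines its odd numerator and its denominator. *)
Lemma dyad_inj : injective dyad.
Proof.
suff main j k : (lev j <= lev k)%N -> dyad j = dyad k -> j = k.
  move=> j k jk; case/orP: (leq_total (lev j) (lev k)) => h; first exact: main.
  by apply/esym/main.
move=> jk /addIr /eqP; rewrite eqr_div; [|by rewrite gt_eqF|by rewrite gt_eqF].
rewrite -!natrX -!natrM eqr_nat.
rewrite -{1}(subnKC jk) !expnS expnD mulnCA [eqbRHS]mulnCA eqn_mul2l/=.
rewrite mulnCA [eqbRHS]mulnC eqn_mul2l expn_eq0/=.
case: (lev k - lev j)%N => [|n] /eqP; first by rewrite expn0; lia.
by rewrite expnS; lia.
Qed.

Lemma dyad_between x y : 0 <= x -> x < y -> y <= 1 -> exists2 k, x < dyad k & dyad k <= y.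
Proof.
move=> x0 xy y1.
pose n := (Num.truncn (2 / (y - x))).+1.
have yx0 : 0 < y - x by rewrite subr_gt0.
have nlt : 2 / (y - x) < 2 ^+ n.
  apply: (@lt_trans _ _ n%:R); first exact: truncnS_gt.
  by rewrite -natrX ltr_nat ltn_expl.
have n2 : 2 / 2 ^+ n < y - x by rewrite ltr_pdivrMr// mulrC -ltr_pdivrMr.
(* the node of the dyadic interval that follows the one of x *)
pose j := Num.truncn (2 ^+ n * x).
have /andP[j1 j2] : j%:R <= 2 ^+ n * x < j.+1%:R.
  by rewrite truncn_itv// mulr_ge0// ltW.
have xj : j%:R / 2 ^+ n <= x by rewrite ler_pdivrMr// mulrC.
have xj' : x < j.+1%:R / 2 ^+ n by rewrite ltr_pdivlMr// mulrC.
have jn : (j.+1 < 2 ^ n)%N.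
  rewrite -(ltr_nat R) natrX -[ltRHS]mul1r -ltr_pdivrMr// -natr1 mulrDl mul1r.
  have i0 : 0 < (2 ^+ n : R)^-1 by rewrite invr_gt0.
  lra.
pose k := (2 ^ n + j)%N.
have lk : lev k = n.
  by apply: lev_eq; rewrite expnS; lia.
have dk : dyad k = j.+1%:R / 2 ^+ n + 2^-1 / 2 ^+ n.
  have -> : dyad k = (2 * 2 ^+ n + 2 * j%:R + 3) / (2 * 2 ^+ n) - 1.
    by rewrite /dyad lk /k exprS natrD -mul2n natrM natrD natrX mulrDr.
  rewrite -(natr1 j).
  by field; rewrite gt_eqF.
exists k; rewrite dk.
  by rewrite ltr_wpDr// mulr_ge0// ?invr_ge0// ltW.
rewrite -natr1 mulrDl mul1r.
have i0 : 0 < (2 ^+ n : R)^-1 by rewrite invr_gt0.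
lra.
Qed.

Lemma cell_cover n x : 0 <= x -> x < 1 ->
  exists k, [/\ lev k = n, cell_l k <= x & x < cell_r k].
Proof.
move=> x0 x1; pose j := Num.truncn (2 ^+ n * x).
have /andP[j1 j2] : j%:R <= 2 ^+ n * x < j.+1%:R.
  by rewrite truncn_itv// mulr_ge0// ltW.
have jn : (j < 2 ^ n)%N.
  rewrite -(ltr_nat R) natrX; apply: (le_lt_trans j1).
  by rewrite -[ltRHS]mulr1 ltr_pM2l.
have n0 : (0 < 2 ^ n)%N by rewrite expn_gt0.
pose k := (2 ^ n + j).-1.
have k1 : k.+1 = (2 ^ n + j)%N by rewrite /k prednK//; lia.
have lk : lev k = n.
  by apply: lev_eq; rewrite expnS k1; lia.
exists k; split => //.
  by rewrite /cell_l lk lerBlDr ler_pdivrMr// k1 natrD natrX mulrDl mul1r; lra.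
by rewrite /cell_r lk ltrBrDr ltr_pdivlMr// k1 -addnS natrD natrX mulrDl mul1r; lra.
Qed.

(** The nodes inside a cell are the descendants of its node: t generations below
    the label i they occupy the 2 ^ t labels from i * 2 ^ t on. *)
Lemma dyad_in_cell k j : cell_l k < dyad j -> dyad j < cell_r k ->
  (lev k <= lev j)%N &&
  (k.+1 * 2 ^ (lev j - lev k) <= j.+1 < k.+1 * 2 ^ (lev j - lev k) + 2 ^ (lev j - lev k))%N.
Proof.
rewrite /cell_l /cell_r /dyad !ltrD2r.
have e0 n : (0 < 2 ^ n)%N by rewrite expn_gt0.
rewrite ltr_pdivrMr// mulrAC ltr_pdivlMr// => h1.
rewrite ltr_pdivrMr// mulrAC ltr_pdivlMr// => h2; move: h1 h2.
rewrite -!natrX -!natrM !ltr_nat.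
case: (leqP (lev k) (lev j)) => h; rewrite ?andTb ?andFb.
  rewrite -{1 2}(subnKC h) -[(lev k + _).+1]addnS !expnD.
  rewrite expnS => h1 h2; apply/andP; split.
    exact: descendant_ge h1.
  exact: descendant_lt h2.
rewrite -(subnKC h) expnD => h1 h2.
by have := no_shallow_descendant (e0 _) h1 h2.
Qed.
End Dyadic.

(** * The jump function of the gaps *)

Section WeightedSum.
Variables (R : realType) (w : nat -> R).
Hypothesis w_ge0 : forall k, 0 <= w k.
Hypothesis cvg_w : series w @ \oo --> (1 : R).
Implicit Types p : pred nat.

Definition wseries p : nat -> R := series (fun k => w k * (p k)%:R).
(** The mass of p under the discrete probability with weights w. *)
Definition wsum p : R := limn (wseries p).

Let nd_wseries p : nondecreasing_seq (wseries p).
Proof. by apply: nondecreasing_series => k _ _; rewrite mulr_ge0. Qed.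

Let nd_series : nondecreasing_seq (series w).
Proof. by apply: nondecreasing_series => k _ _. Qed.

Let is_cvg_w : cvgn (series w). Proof. by apply/cvg_ex; exists 1. Qed.

Lemma wseries_le1 p n : wseries p n <= 1.
Proof.
apply: (@le_trans _ _ (series w n)).
  by apply: ler_sum => k _; rewrite ler_piMr// lern1 leq_b1.
have lim1 : limn (series w) = 1 by exact/cvg_lim.
by rewrite -[leRHS]lim1; exact: nondecreasing_cvgn_le.
Qed.

Lemma is_cvg_wseries p : cvgn (wseries p).
Proof.
apply: nondecreasing_is_cvgn; first exact: nd_wseries.
by exists 1 => _ [n _ <-]; exact: wseries_le1.
Qed.

Lemma wseries_le_wsum p n : wseries p n <= wsum p.
Proof. by apply: nondecreasing_cvgn_le; [exact: nd_wseries|exact: is_cvg_wseries]. Qed.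

Lemma wsum_le_bound p c : (forall n, wseries p n <= c) -> wsum p <= c.
Proof.
by move=> pc; apply: limr_le; [exact: is_cvg_wseries|exact: nearW].
Qed.

Lemma wsum_ge0 p : 0 <= wsum p.
Proof.
by apply: le_trans (wseries_le_wsum p 0); rewrite /wseries /series/= big_geq.
Qed.

Lemma wsum_le1 p : wsum p <= 1.
Proof. by apply: wsum_le_bound => n; exact: wseries_le1. Qed.

Lemma wsum_le_add p p' c :
  (forall n, \sum_(0 <= k < n) w k * (p k && ~~ p' k)%:R <= c) ->
  wsum p <= wsum p' + c.
Proof.
move=> h; apply: wsum_le_bound => n.
apply: le_trans (lerD (wseries_le_wsum p' n) (h n)).
rewrite /wseries /series/= -big_split/=; apply: ler_sum => k _.
by rewrite -mulrDr ler_wpM2l// -natrD ler_nat; case: (p k); case: (p' k).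
Qed.

Lemma wsum_le p p' : (forall k, p k -> p' k) -> wsum p <= wsum p'.
Proof.
move=> pp'; rewrite -[leRHS]addr0; apply: wsum_le_add => n.
rewrite big1// => k _; case: (boolP (p k)) => pk; last by rewrite mulr0.
by rewrite pp'//= mulr0.
Qed.

Lemma wsum_add_le p p' i : (forall k, p k -> p' k) -> p' i -> ~~ p i ->
  wsum p + w i <= wsum p'.
Proof.
move=> pp' p'i pi; rewrite -lerBrDr; apply: wsum_le_bound => n.
rewrite lerBrDr.
apply: (@le_trans _ _ (wseries p (maxn n i.+1) + w i)).
  by rewrite lerD2r; apply: nd_wseries; exact: leq_maxl.
apply: le_trans (wseries_le_wsum p' (maxn n i.+1)).
have -> : w i = \sum_(0 <= k < maxn n i.+1) w k * (k == i)%:R.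
  rewrite (bigD1_seq i)/= ?mem_index_iota ?iota_uniq//; last by rewrite leq_max ltnSn orbT.
  rewrite eqxx mulr1 big1 ?addr0// => k /negPf ->; exact: mulr0.
rewrite /wseries /series/= -big_split/=; apply: ler_sum => k _.
rewrite -mulrDr ler_wpM2l// -natrD ler_nat.
have [->|_] := eqVneq k i; first by rewrite (negPf pi) p'i.
by case: (boolP (p k)) => // /pp' ->.
Qed.
End WeightedSum.

Section CantorFunction.
Variables (R : realType) (g : nat -> R).
Hypothesis g_gt0 : forall n, 0 < g n.
Hypothesis g_sum : series (fun n => 2 ^+ n * g n) @ \oo --> (1 : R).
Variable C : R.
Hypothesis g_tail : forall n N,
  \sum_(n <= m < N) 2 ^+ m * g m <= C * (2 ^+ n * g n).
Implicit Types (x y : R) (k : nat).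

Definition node_gap k : R := g (lev k).

Let gap_ge0 k : 0 <= node_gap k. Proof. exact/ltW/g_gt0. Qed.

Lemma series_node_gap N : series node_gap (2 ^ N).-1 = series (fun n => 2 ^+ n * g n) N.
Proof.
rewrite /series/= /node_gap (sum_lev g); apply: eq_bigr => n _.
by rewrite -[LHS]mulr_natl natrX.
Qed.

Lemma cvg_node_gap : series node_gap @ \oo --> (1 : R).
Proof.
have nd : nondecreasing_seq (series node_gap).
  by apply: nondecreasing_series => k _ _; exact: gap_ge0.
have nd' : nondecreasing_seq (series (fun n => 2 ^+ n * g n)).
  by apply: nondecreasing_series => k _ _; rewrite mulr_ge0 ?exprn_ge0// ltW.
have lim1 : limn (series (fun n => 2 ^+ n * g n)) = 1 by exact/cvg_lim.
have is1 : cvgn (series (fun n => 2 ^+ n * g n)) by apply/cvg_ex; exists 1.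
have ub n : series node_gap n <= 1.
  apply: (le_trans (nd _ _ (leq_pred_exp2 n))); rewrite series_node_gap.
  by rewrite -[leRHS]lim1; exact: nondecreasing_cvgn_le.
have cv : cvgn (series node_gap).
  by apply: nondecreasing_is_cvgn => //; exists 1 => _ [n _ <-]; exact: ub.
suff <- : limn (series node_gap) = 1 by [].
apply/eqP; rewrite eq_le; apply/andP; split.
  by apply: limr_le => //; exact: nearW.
rewrite -[leLHS]lim1; apply: limr_le => //; apply: nearW => n.
by rewrite -series_node_gap; exact: nondecreasing_cvgn_le.
Qed.

(** Distribution function of the discrete probability that puts the length of
    each gap at its node. It maps the unit interval into the Cantor set, opening
    the k-th gap at dyad k. *)
Definition jump x : R := wsum node_gap (fun k => dyad R k <= x).
(** The left limit of jump at x. *)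
Definition jump_left x : R := wsum node_gap (fun k => dyad R k < x).

Lemma jump_le x y : x <= y -> jump x <= jump y.
Proof. by move=> xy; apply: (wsum_le gap_ge0 cvg_node_gap) => k kx; exact: le_trans xy. Qed.

Lemma jump_left_ge0 x : 0 <= jump_left x.
Proof. exact: (wsum_ge0 gap_ge0 cvg_node_gap). Qed.

Lemma jump_ge0 x : 0 <= jump x.
Proof. exact: (wsum_ge0 gap_ge0 cvg_node_gap). Qed.

Lemma jump_le1 x : jump x <= 1.
Proof. exact: (wsum_le1 gap_ge0 cvg_node_gap). Qed.

Lemma jump_left_le1 x : jump_left x <= 1.
Proof. exact: (wsum_le1 gap_ge0 cvg_node_gap). Qed.

Lemma jump_left_le x : jump_left x <= jump x.
Proof. by apply: (wsum_le gap_ge0 cvg_node_gap) => k /ltW. Qed.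

Lemma jump_lt_left x y : x < y -> jump x <= jump_left y.
Proof. by move=> xy; apply: (wsum_le gap_ge0 cvg_node_gap) => k kx; exact: le_lt_trans xy. Qed.

(** Distinct nodes sit at distinct points, so a single gap opens at each of them. *)
Lemma jump_dyad k : jump (dyad R k) = jump_left (dyad R k) + node_gap k.
Proof.
apply/eqP; rewrite eq_le; apply/andP; split.
  apply: (wsum_le_add gap_ge0 cvg_node_gap) => n.
  rewrite (eq_bigr (fun j => if j == k then node_gap k else 0)); last first.
    move=> j _; rewrite -leNgt -eq_le (inj_eq (@dyad_inj R)).
    by case: eqP => [->|_]; rewrite ?mulr1 ?mulr0.
  rewrite -big_mkcond -big_filter/= (@le_trans _ _ (\sum_(i <- [:: k]) node_gap k))//; last first.
    by rewrite big_seq1.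
  rewrite !big_const_seq !count_predT !iter_addr_0/= ler_wpMn2l//.
  rewrite -[leqRHS]/(size [:: k]); apply: uniq_leq_size.
    by rewrite filter_uniq// iota_uniq.
  by move=> j; rewrite mem_filter mem_seq1 => /andP[].
apply: (wsum_add_le gap_ge0 cvg_node_gap) => //.
- by move=> j /ltW.
- by rewrite ltxx.
Qed.

Lemma jump_lt x y : 0 <= x -> x < y -> y <= 1 -> jump x < jump y.
Proof.
move=> x0 xy y1; have [k xk ky] := dyad_between x0 xy y1.
apply: (@lt_le_trans _ _ (jump x + node_gap k)); first by rewrite ltrDl g_gt0.
apply: (wsum_add_le gap_ge0 cvg_node_gap) => //.
- by move=> j /le_trans; apply; exact: ltW.
- by rewrite -ltNge.
Qed.

(** The cell of k contains a fraction 2 ^ - lev k of the nodes of every generation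
    from lev k on, and no node of an earlier one; the tail estimate for the series of
    lengths concludes. *)
Lemma jump_cell k : jump_left (cell_r R k) <= jump (cell_l R k) + C * node_gap k.
Proof.
apply: (wsum_le_add gap_ge0 cvg_node_gap) => N; set n := lev k.
pose F j := node_gap j * ((dyad R j < cell_r R k) && ~~ (dyad R j <= cell_l R k))%:R.
apply: (@le_trans _ _ (\sum_(0 <= j < (2 ^ N).-1) F j)).
  rewrite [leRHS](@big_cat_nat _ _ _ N)//= ?leq_pred_exp2// lerDl sumr_ge0//.
  by move=> j _; rewrite mulr_ge0.
rewrite sum_blocks.
apply: (@le_trans _ _ (\sum_(0 <= m < N) if (n <= m)%N then g m *+ 2 ^ (m - n) else 0)).
  apply: ler_sum => m _.
  pose P j := (lev j == m) && (dyad R j < cell_r R k) && ~~ (dyad R j <= cell_l R k).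
  rewrite (eq_big_nat _ _ (F2 := fun j => g m * (P j)%:R)); last first.
    by move=> j; rewrite lev_block => /eqP jm; rewrite /F /P /node_gap jm eqxx.
  have PP j : P j -> (n <= m)%N && (k.+1 * 2 ^ (m - n) <= j.+1 < k.+1 * 2 ^ (m - n) + 2 ^ (m - n))%N.
    move=> /andP[/andP[/eqP <- h1]]; rewrite -ltNge => h2.
    exact: dyad_in_cell h2 h1.
  case: ifPn => nm.
    apply: (@sum_indicator_le _ _ _ (k.+1 * 2 ^ (m - n)).-1); first exact: ltW.
    move=> j /PP; rewrite nm/=.
    have : (0 < k.+1 * 2 ^ (m - n))%N by rewrite muln_gt0 expn_gt0.
    by case: (k.+1 * _)%N => // a _ /=; rewrite addSn !ltnS.
  rewrite big1// => j _; case: (boolP (P j)) => [/PP|_]; last by rewrite mulr0.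
  by rewrite (negPf nm).
rewrite -big_mkcond (eq_bigl (fun m => true && (n <= m)%N))//.
rewrite -(big_nat_widenl n 0)//.
rewrite (eq_big_nat _ _ (F2 := fun m => (2 ^+ n)^-1 * (2 ^+ m * g m))); last first.
  move=> m /andP[nm _]; rewrite -[X in _ ^+ X * _](subnKC nm) exprD -!mulrA mulKf ?gt_eqF ?exprn_gt0//.
  by rewrite -natrX mulr_natl.
rewrite -mulr_sumr ler_pdivrMl ?exprn_gt0// (le_trans (g_tail n N))//.
by rewrite mulrCA.
Qed.

(** If dyad j < dyad k then the j-th gap ends before the k-th one starts, by
    monotonicity of the distribution function. *)
Lemma jump_gap_disjoint j k t : j != k ->
  jump_left (dyad R j) < t < jump (dyad R j) ->
  jump_left (dyad R k) < t < jump (dyad R k) -> False.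
Proof.
move=> jk /andP[h1 h2] /andP[h3 h4].
have := jk; rewrite -(inj_eq (@dyad_inj R)) neq_lt => /orP[] /jump_lt_left.
  by move=> h; have := lt_trans (lt_le_trans h2 h) h3; rewrite ltxx.
by move=> h; have := lt_trans (lt_le_trans h4 h) h1; rewrite ltxx.
Qed.

Lemma jump_notin_gap k x :
  jump x <= jump_left (dyad R k) \/ jump (dyad R k) <= jump x.
Proof.
by case: (ltP x (dyad R k)) => h; [left; exact: jump_lt_left|right; exact: jump_le].
Qed.

Lemma jump_in_cell k x : cell_l R k <= x -> x < cell_r R k ->
  jump (cell_l R k) <= jump x <= jump_left (cell_r R k).
Proof. by move=> h1 h2; rewrite jump_le//= jump_lt_left. Qed.

Lemma in_cell_of_jump k x : 0 <= x -> x <= 1 ->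
  jump (cell_l R k) <= jump x <= jump_left (cell_r R k) ->
  cell_l R k <= x <= cell_r R k.
Proof.
move=> x0 x1 /andP[h1 h2]; apply/andP; split; rewrite leNgt; apply/negP => h.
  have l1 : cell_l R k <= 1.
    by rewrite (le_trans _ (cell_r_le1 R k))// ltW// (lt_trans (cell_l_dyad R k))// dyad_cell_r.
  by have := jump_lt x0 h l1; rewrite ltNge h1.
have r0 : 0 <= cell_r R k.
  by rewrite (le_trans (cell_l_ge0 R k))// ltW// (lt_trans (cell_l_dyad R k))// dyad_cell_r.
by have := jump_lt r0 h x1; rewrite ltNge (le_trans h2)// jump_left_le.
Qed.

Lemma gap_in_cell k :
  jump (cell_l R k) <= jump_left (dyad R k) /\ jump (dyad R k) <= jump_left (cell_r R k).
Proof.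
by split; apply: jump_lt_left; [exact: cell_l_dyad|exact: dyad_cell_r].
Qed.
End CantorFunction.

(** * Coordinates, chords and the exponential on the circle *)

Lemma hausdorff_injective (S T : topologicalType) (f : S -> T) :
  continuous f -> injective f -> hausdorff_space T -> hausdorff_space S.
Proof.
move=> cf finj hT p q pq; apply: finj; apply: hT => A B fpA fqB.
by have [z [zA zB]] := pq _ _ (cf p _ fpA) (cf q _ fqB); exists (f z).
Qed.

Section Circle.
Variable R : realType.
Implicit Types (a b x y : R) (xi zeta : circle R).

Lemma normc_Re (z : R[i]) : `|complex.Re z| <= Normc.normc z.
Proof.
by case: z => a b /=; rewrite -sqrtr_sqr ler_wsqrtr// lerDl sqr_ge0.
Qed.

Lemma normc_Im (z : R[i]) : `|complex.Im z| <= Normc.normc z.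
Proof.
by case: z => a b /=; rewrite -sqrtr_sqr ler_wsqrtr// lerDr sqr_ge0.
Qed.

Lemma continuous_Re : continuous (@complex.Re R : R[i]^o -> R).
Proof.
move=> z; apply/(@cvgrPdist_lt R R^o R[i]^o (nbhs (z : R[i]^o))) => e e0.
have e0' : 0 < (e%:C : R[i]) by rewrite ltcR.
have /cvgrPdist_lt/(_ _ e0') h : (fun t : R[i]^o => t) @ z --> z by exact: cvg_id.
near=> t; have : `|z - t| < e%:C by near: t; exact: h.
rewrite ltcR; apply: le_lt_trans.
by apply: le_trans (normc_Re (z - t)); rewrite raddfB.
Unshelve. all: by end_near. Qed.

Lemma continuous_Im : continuous (@complex.Im R : R[i]^o -> R).
Proof.
move=> z; apply/(@cvgrPdist_lt R R^o R[i]^o (nbhs (z : R[i]^o))) => e e0.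
have e0' : 0 < (e%:C : R[i]) by rewrite ltcR.
have /cvgrPdist_lt/(_ _ e0') h : (fun t : R[i]^o => t) @ z --> z by exact: cvg_id.
near=> t; have : `|z - t| < e%:C by near: t; exact: h.
rewrite ltcR; apply: le_lt_trans.
by apply: le_trans (normc_Im (z - t)); rewrite raddfB.
Unshelve. all: by end_near. Qed.

Definition re_circ xi : R := complex.Re (circle_val xi).
Definition im_circ xi : R := complex.Im (circle_val xi).

Lemma continuous_circle_val : continuous (@circle_val R).
Proof. exact: initial_continuous. Qed.

Lemma continuous_re_circ : continuous re_circ.
Proof.
move=> x; apply: continuous_comp; first exact: continuous_circle_val.
exact: continuous_Re.
Qed.

Lemma continuous_im_circ : continuous im_circ.
Proof.
move=> x; apply: continuous_comp; first exact: continuous_circle_val.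
exact: continuous_Im.
Qed.

Lemma circle_val_inj : injective (@circle_val R).
Proof. by move=> x y; rewrite /circle_val !set_valE; exact: val_inj. Qed.

Lemma hausdorff_circle : hausdorff_space (circle R).
Proof.
apply: (hausdorff_injective continuous_circle_val circle_val_inj).
exact: norm_hausdorff.
Qed.

Lemma circleE xi : re_circ xi ^+ 2 + im_circ xi ^+ 2 = 1.
Proof.
have := set_valP xi; rewrite /unit_circle/=.
rewrite normc_def => /(congr1 (@complex.Re R))/= h.
have := congr1 (fun x => x ^+ 2) h; rewrite sqr_sqrtr ?addr_ge0 ?sqr_ge0//.
by rewrite expr1n.
Qed.

Lemma circle_ext xi zeta : re_circ xi = re_circ zeta -> im_circ xi = im_circ zeta -> xi = zeta.
Proof.
move=> h1 h2; apply: circle_val_inj; move: h1 h2; rewrite /re_circ /im_circ.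
by case: (circle_val xi) (circle_val zeta) => a b [c d] /= -> ->.
Qed.

Lemma re_circle_exp x : re_circ (circle_exp x) = cos (2 * pi * x).
Proof. by rewrite /re_circ /circle_val set_valE/= expR0 mul1r. Qed.

Lemma im_circle_exp x : im_circ (circle_exp x) = sin (2 * pi * x).
Proof. by rewrite /im_circ /circle_val set_valE/= expR0 mul1r. Qed.

Definition chord2 xi zeta : R :=
  (re_circ xi - re_circ zeta) ^+ 2 + (im_circ xi - im_circ zeta) ^+ 2.

Lemma chord2_exp a b :
  chord2 (circle_exp a) (circle_exp b) = 2 - 2 * cos (2 * pi * (a - b)).
Proof.
rewrite /chord2 !re_circle_exp !im_circle_exp mulrBr cosB.
have h1 := cos2Dsin2 (2 * pi * a); have h2 := cos2Dsin2 (2 * pi * b).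
move: h1 h2; move: (cos _) (sin _) (cos (_ * b)) (sin (_ * b)) => c s c' s' h1 h2.
lra.
Qed.

Lemma sin_half_sqr x : 2 - 2 * cos (2 * x) = 4 * sin x ^+ 2.
Proof.
by rewrite (mulr_natl x 2) cos_mulr2n cos2sin2; ring.
Qed.

Lemma sin_eq0_small x : - pi < x < pi -> sin x = 0 -> x = 0.
Proof.
move=> /andP[h1 h2] sx.
have [x0|x0|//] := ltgtP x 0.
  have : 0 < sin (- x) by apply: sin_gt0_pi; lra.
  by rewrite sinN sx oppr0 ltxx.
have : 0 < sin x by apply: sin_gt0_pi; lra.
by rewrite sx ltxx.
Qed.

(** A vanishing chord forces sin (pi * (a - b)) = 0; excluding the end points for
    a keeps the angle strictly between - pi and pi. *)
Lemma circle_exp_inj a b : 0 < a < 1 -> 0 <= b <= 1 ->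
  circle_exp a = circle_exp b -> a = b.
Proof.
move=> /andP[a0 a1] /andP[b0 b1] ab; have := chord2_exp a b.
rewrite {1}ab /chord2 !subrr expr0n/= addr0 -mulrA sin_half_sqr => /esym/eqP.
rewrite mulf_eq0 pnatr_eq0/= sqrf_eq0 => /eqP/sin_eq0_small h.
apply/eqP; rewrite -subr_eq0; have p0 := pi_gt0 R.
suff /eqP : pi * (a - b) = 0 by rewrite mulf_eq0 gt_eqF.
apply: h; apply/andP; split.
  by rewrite -mulrN1 ltr_pM2l//; lra.
by rewrite -[ltRHS]mulr1 ltr_pM2l//; lra.
Qed.

Lemma circle_exp_surj xi : exists2 x, 0 <= x <= 1 & circle_exp x = xi.
Proof.
have p0 := pi_gt0 R; have e := circleE xi.
have pn0 : pi != 0 :> R by rewrite gt_eqF.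
set c := re_circ xi in e; set s := im_circ xi in e.
have c1 : -1 <= c <= 1.
  rewrite -ler_norml -(@expr_le1 _ 2)// real_normK ?num_real//.
  by have := sqr_ge0 s; lra.
have ac0 := acos_ge0 c1; have acpi := acos_lepi c1.
have cac : cos (acos c) = c by rewrite acosK.
have sac : sin (acos c) = `|s|.
  by rewrite sin_acos// -sqrtr_sqr; congr Num.sqrt; lra.
have [s0|s0] := leP 0 s.
  exists (acos c / (2 * pi)).
    rewrite divr_ge0 ?mulr_ge0 ?(ltW p0)//= ler_pdivrMr ?mulr_gt0//; lra.
  have tE : 2 * pi * (acos c / (2 * pi)) = acos c.
    by move: (acos c) (@pi R) pn0 => A P P0; field.
  apply: circle_ext; rewrite ?re_circle_exp ?im_circle_exp tE//.
  by rewrite sac ger0_norm.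
exists (1 - acos c / (2 * pi)).
  rewrite subr_ge0 ler_pdivrMr ?mulr_gt0// gerBl divr_ge0 ?mulr_ge0 ?(ltW p0)//.
  by rewrite andbT; lra.
have tE : 2 * pi * (1 - acos c / (2 * pi)) = - acos c + pi *+ 2.
  by move: (acos c) (@pi R) pn0 => A P P0; field.
apply: circle_ext; rewrite ?re_circle_exp ?im_circle_exp tE.
  by rewrite cosD2pi cosN.
by rewrite sinD2pi sinN sac ltr0_norm// opprK.
Qed.

Lemma sin_sqr_le x : sin x ^+ 2 <= x ^+ 2.
Proof.
wlog x0 : x / 0 <= x.
  move=> H; have [|x0] := leP 0 x; first exact: H.
  by rewrite -(sqrrN x) -(sqrrN (sin x)) -sinN H// oppr_ge0 ltW.
have [c _] := @MVT_segment R sin cos 0 x x0 (fun y _ => is_derive_sin y)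
  (continuous_subspaceT (@continuous_sin R)).
by rewrite sin0 !subr0 => ->; rewrite exprMn ler_piMl ?sqr_ge0//.
Qed.

Lemma chord2_le a b : chord2 (circle_exp a) (circle_exp b) <= 4 * pi ^+ 2 * (a - b) ^+ 2.
Proof.
rewrite chord2_exp -mulrA sin_half_sqr -mulrA -exprMn ler_pM2l//.
exact: sin_sqr_le.
Qed.

(** Folding the angle by the symmetry t -> 1 - t reduces this to the monotonicity
    of cos on the interval from 0 to pi. *)
Lemma chord2_ge a b (h : R) : 0 < h -> h <= `|a - b| -> `|a - b| <= 1 - h ->
  2 - 2 * cos (2 * pi * h) <= chord2 (circle_exp a) (circle_exp b).
Proof.
move=> h0 h1 h2; have p0 := pi_gt0 R.
rewrite chord2_exp lerD2l lerN2 ler_pM2l//.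
have -> : cos (2 * pi * (a - b)) = cos (2 * pi * `|a - b|).
  by rewrite -cos_norm normrM ger0_norm// mulr_ge0// ltW.
move: `|a - b| h1 h2 => t h1 h2.
wlog t12 : t h1 h2 / t <= 1 / 2.
  move=> H; have [t12|t12] := leP t (1 / 2); first exact: H.
  have -> : cos (2 * pi * t) = cos (2 * pi * (1 - t)).
    have -> : 2 * pi * (1 - t) = - (2 * pi * t) + pi *+ 2 by ring.
    by rewrite cosD2pi cosN.
  by apply: H; lra.
have pt x : 0 <= x -> x <= 1/2 -> 2 * pi * x \in `[0, pi].
  move=> x0 x12; rewrite in_itv/= !mulr_ge0 ?(ltW p0)//=.
  by rewrite mulrAC ler_piMl ?(ltW p0)//; lra.
have : 2 * pi * h <= 2 * pi * t by rewrite ler_pM2l// mulr_gt0.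
rewrite le_eqVlt => /predU1P[->//|ht]; apply/ltW.
by rewrite ltr_cos// pt//; lra.
Qed.

Lemma chord2_min_gt0 (h : R) : 0 < h -> h <= 1 / 2 -> 0 < 2 - 2 * cos (2 * pi * h).
Proof.
move=> h0 h1; have p0 := pi_gt0 R; rewrite -mulrA sin_half_sqr.
rewrite mulr_gt0// exprn_gt0// sin_gt0_pi// mulr_gt0//=.
by rewrite gtr_pMr//; lra.
Qed.

End Circle.

(** * Arcs, the Cantor set and its complementary arcs *)

(** Each piece is open, and closed relatively to the union because the other
    pieces form an open set; so a connected subset cannot leave it. *)
Lemma components_bigcup (T : topologicalType) (G : nat -> set T) :
  (forall k, open (G k)) -> (forall k, connected (G k)) ->
  (forall k, G k !=set0) -> trivIset setT G ->
  components (\bigcup_k G k) = [set G k | k in [set: nat]].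
Proof.
move=> oG cG nG tG.
have cc k x : G k x -> connected_component (\bigcup_k G k) x = G k.
  move=> Gkx; apply/seteqP; split; last first.
    by apply: connected_component_max => //; exact: bigcup_sup.
  set C := connected_component _ _.
  have CG : C `<=` \bigcup_k G k by exact: connected_component_sub.
  have Cx : C x by apply: connected_component_refl; exists k.
  have /(_ (C `&` G k)) CC : connected C by exact: component_connected.
  rewrite -{1}CC; first exact: subIsetr.
  - by exists x.
  - by exists (G k).
  - exists (~` \bigcup_(j in [set j | j != k]) G j).
      by apply: open_closedC; exact: bigcup_open.
    apply/seteqP; split=> y [Cy Gy]; split => //.
      move=> [j /= jk Gjy]; have /trivIsetP/(_ j k I I jk) := tG.
      by move/seteqP => [+ _] => /(_ y); apply.
    have [j _ Gjy] := CG _ Cy; have [<-//|jk] := eqVneq j k.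
    by exfalso; apply: Gy; exists j.
apply/seteqP; split => [_ [x [k _ Gkx] <-]|_ [k _ <-]].
  by exists k => //; rewrite (cc k).
by have [x Gkx] := nG k; exists x; [exists k|exact: cc].
Qed.

Section Arcs.
Variable R : realType.
Implicit Types (a b x y : R) (xi zeta : circle R).

Lemma open_measurable_circle (A : set (circle R)) : open A -> measurable A.
Proof. exact: sub_sigma_algebra. Qed.

Lemma closed_measurable_circle (A : set (circle R)) : closed A -> measurable A.
Proof.
move=> cA; rewrite -(setCK A); apply: measurableC; apply: open_measurable_circle.
exact: closed_openC.
Qed.

Definition circ_arc a b : set (circle R) := @circle_exp R @` `]a, b[.
Definition closed_arc a b : set (circle R) := @circle_exp R @` `[a, b].

Lemma closed_closed_arc a b : closed (closed_arc a b).
Proof.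
apply: compact_closed; first exact: hausdorff_circle.
apply: continuous_compact; last exact: segment_compact.
exact/continuous_subspaceT/continuous_circle_exp.
Qed.

Lemma arcE a b x : 0 <= a -> b <= 1 -> 0 <= x <= 1 ->
  circ_arc a b (circle_exp x) <-> a < x < b.
Proof.
move=> a0 b1 x01; split => [[y /=]|axb]; last by exists x => //=; rewrite in_itv.
rewrite in_itv/= => /andP[ay yb] /circle_exp_inj <-//; rewrite ?ay//.
by rewrite (le_lt_trans a0 ay) (lt_le_trans yb b1).
Qed.

(** The complement is the image of two segments, hence compact. *)
Lemma open_arc a b : 0 <= a -> b <= 1 -> open (circ_arc a b).
Proof.
move=> a0 b1; rewrite -(setCK (circ_arc a b)); apply: closed_openC.
suff -> : ~` circ_arc a b = closed_arc 0 a `|` closed_arc b 1.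
  by apply: closedU; exact: closed_closed_arc.
apply/seteqP; split => [xi|xi [|]].
- have [x /andP[x0 x1] <-] := circle_exp_surj xi.
  move=> /(@contra_not _ _ (arcE a0 b1 _).2) => /(_ _).
  rewrite x0 x1 => /(_ isT)/negP; rewrite negb_and -!leNgt => /orP[xa|bx].
    by left; exists x => //=; rewrite in_itv/= x0.
  by right; exists x => //=; rewrite in_itv/= x1 bx.
- move=> [x /= + <-]; rewrite in_itv/= => /andP[x0 xa] /[dup] [[y /=]].
  rewrite in_itv/= => /andP[ay yb] e.
  have y01 : 0 < y < 1 by rewrite (le_lt_trans a0 ay) (lt_le_trans yb b1).
  have y01' : 0 <= x <= 1.
    by rewrite x0 (le_trans xa)// (le_trans (ltW ay))// (le_trans (ltW yb)).
  by have := circle_exp_inj y01 y01' e => yx; move: ay; rewrite yx ltNge xa.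
- move=> [x /= + <-]; rewrite in_itv/= => /andP[bx x1] /[dup] [[y /=]].
  rewrite in_itv/= => /andP[ay yb] e.
  have y01 : 0 < y < 1 by rewrite (le_lt_trans a0 ay) (lt_le_trans yb b1).
  have y01' : 0 <= x <= 1.
    by rewrite x1 andbT (le_trans _ bx)// (le_trans _ (ltW yb))// (le_trans a0)// ltW.
  by have := circle_exp_inj y01 y01' e => yx; move: yb; rewrite yx ltNge bx.
Qed.

Lemma connected_arc a b : connected (circ_arc a b).
Proof.
apply: connected_continuous_connected.
  by apply/connected_intervalP; exact: interval_is_interval.
exact/continuous_subspaceT/continuous_circle_exp.
Qed.

Lemma measurable_arc a b : 0 <= a -> b <= 1 -> measurable (circ_arc a b).
Proof. by move=> a0 b1; apply: open_measurable_circle; exact: open_arc. Qed.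

Lemma arclength_arc a b : 0 <= a -> a <= b -> b <= 1 -> arclength (circ_arc a b) = (b - a)%:E.
Proof.
move=> a0 ab b1; rewrite /arclength /pushforward /mrestr.
have -> : @circle_exp R @^-1` circ_arc a b `&` `[0, 1[ = `]a, b[%classic.
  apply/seteqP; split => x /=.
    rewrite !in_itv/= => -[+ /andP[x0 x1]].
    by move/(arcE a0 b1) => ->//; rewrite x0 ltW.
  rewrite !in_itv/= => axb; have /andP[ax xb] := axb.
  have x01 : 0 <= x < 1 by rewrite (le_trans a0 (ltW ax)) (lt_le_trans xb b1).
  by split => //; exists x => //=; rewrite in_itv.
rewrite lebesgue_measure_itv/= lte_fin.
by move: ab; rewrite le_eqVlt => /predU1P[->|->]; rewrite ?ltxx ?subrr// -EFinB.
Qed.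
End Arcs.

Section ImageMeasure.
Variable R : realType.

Definition unit_lebesgue : set (measurableTypeR R) -> \bar R :=
  mrestr (@lebesgue_measure R) (measurable_itv `](0 : R), 1[).

HB.instance Definition _ := Measure.on unit_lebesgue.

Lemma unit_lebesgueT : unit_lebesgue setT = 1%E.
Proof.
by rewrite /unit_lebesgue /mrestr setTI lebesgue_measure_itv/= lte_fin ltr01 oppr0 adde0.
Qed.

HB.instance Definition _ := Measure_isProbability.Build _ _ _ unit_lebesgue unit_lebesgueT.

(** For a strictly increasing f into the unit interval, the open interval avoids
    the values 0 and 1, which circle_exp identifies. *)
Lemma exists_image_measure (f : R -> R) : {homo f : x y / x <= y} ->
  exists mu : probability (circle R) R, forall A, measurable A ->
    let B := (fun x => circle_exp (f x)) @^-1` A `&` `]0, 1[%classic in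
    measurable (B : set (measurableTypeR R)) /\ mu A = lebesgue_measure B.
Proof.
move=> ndf; pose F : measurableTypeR R -> circle R := fun x => circle_exp (f x).
have mF : measurable_fun setT F.
  apply: measurableT_comp; first exact: measurable_circle_exp.
  exact: nondecreasing_measurable.
pose F' : {mfun measurableTypeR R >-> circle R} :=
  HB.pack F (isMeasurableFun.Build _ _ _ _ F mF).
exists (distribution (unit_lebesgue : probability _ _) F') => A mA; split => //.
by apply: measurableI => //; rewrite -[X in measurable X]setTI; exact: (mF measurableT _ mA).
Qed.
End ImageMeasure.

Section CantorSet.
Variables (R : realType) (g : nat -> R).
Hypothesis g_gt0 : forall n, 0 < g n.
Hypothesis g_sum : series (fun n => 2 ^+ n * g n) @ \oo --> (1 : R).
Implicit Types (k n : nat).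

Local Notation T := (jump g).
Local Notation Tl := (jump_left g).

Definition gap_arc k : set (circle R) := circ_arc (Tl (dyad R k)) (T (dyad R k)).
(** The smallest arc that carries the images of the points of the cell of k. *)
Definition cell_arc k : set (circle R) := closed_arc (T (cell_l R k)) (Tl (cell_r R k)).
Definition cantor_set : set (circle R) := ~` \bigcup_k gap_arc k.

Let gap_ge0 k : 0 <= Tl (dyad R k). Proof. exact: jump_left_ge0 g_gt0 g_sum _. Qed.
Let gap_le1 k : T (dyad R k) <= 1. Proof. exact: jump_le1 g_gt0 g_sum _. Qed.
Let gapE k : T (dyad R k) = Tl (dyad R k) + node_gap g k.
Proof. exact: jump_dyad g_gt0 g_sum _. Qed.

Lemma open_gap_arc k : open (gap_arc k). Proof. exact: open_arc. Qed.

Lemma arclength_gap_arc k : arclength (gap_arc k) = (node_gap g k)%:E.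
Proof.
rewrite arclength_arc ?gap_ge0 ?gap_le1//; last exact: jump_left_le g_gt0 g_sum _.
by rewrite gapE addrAC subrr add0r.
Qed.

Lemma gap_arc_nonempty k : gap_arc k !=set0.
Proof.
exists (circle_exp (Tl (dyad R k) + node_gap g k / 2)); exists (Tl (dyad R k) + node_gap g k / 2) => //=.
by rewrite in_itv/= gapE; have := g_gt0 (lev k); rewrite /node_gap; lra.
Qed.

Lemma trivIset_gap_arc : trivIset setT gap_arc.
Proof.
apply/trivIsetP => j k _ _ jk; rewrite -subset0 => xi [[x /= + <-]].
rewrite in_itv/= => /andP[x1 x2] /arcE => /(_ (gap_ge0 k) (gap_le1 k)).
rewrite (le_trans (gap_ge0 j) (ltW x1)) (le_trans (ltW x2) (gap_le1 j)) => /(_ isT) h.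
by apply: (jump_gap_disjoint g_gt0 g_sum jk _ h); rewrite x1.
Qed.

Lemma closed_cantor_set : closed cantor_set.
Proof. by apply: open_closedC; apply: bigcup_open => k _; exact: open_gap_arc. Qed.

(** The lengths of the gaps add up to 1. *)
Lemma arclength_cantor_set : arclength cantor_set = 0%E.
Proof.
rewrite /cantor_set probability_setC; last first.
  by apply: bigcup_measurable => k _; apply: open_measurable_circle; exact: open_gap_arc.
rewrite measure_bigcup; [|by move=> k _; apply: open_measurable_circle; exact: open_gap_arc|exact: trivIset_gap_arc].
suff -> : (\sum_(0 <= k <oo | k \in [set: nat]) arclength (gap_arc k) = 1)%E by rewrite subee.
apply/cvg_lim => //.
have -> : (fun n => \sum_(0 <= k < n | k \in [set: nat]) arclength (gap_arc k))%E =
    EFin \o series (node_gap g).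
  apply/funext => n /=; rewrite /series/= -sumEFin; apply: eq_big => [k|k _].
    by rewrite in_setT.
  exact: arclength_gap_arc.
by apply: cvg_EFin; [exact: nearW|exact: cvg_node_gap].
Qed.

Lemma components_cantor_set : components (~` cantor_set) = [set gap_arc k | k in [set: nat]].
Proof.
rewrite /cantor_set setCK; apply: components_bigcup.
- exact: open_gap_arc.
- by move=> k; exact: connected_arc.
- exact: gap_arc_nonempty.
- exact: trivIset_gap_arc.
Qed.

(** The complementary arcs are the gaps, each counted once, and their sum is
    condensed by generations. *)
Lemma esum_components (phi : R -> R) (M : R) : (forall x, 0 <= phi x) ->
  (forall N, \sum_(0 <= n < N) 2 ^+ n * phi (g n) <= M) ->
  (\esum_(J in components (~` cantor_set)) (phi (fine (arclength J)))%:E <= M%:E)%E.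
Proof.
move=> phi0 phiM; rewrite components_cantor_set esum_image; last first.
  move=> j k _ _ jk; apply/eqP/negPn/negP => /eqP.
  move/eqP => njk; have /trivIsetP/(_ j k I I njk) := trivIset_gap_arc.
  by rewrite -jk setIid; have /set0P/eqP := gap_arc_nonempty j.
rewrite -nneseries_esumT => [|k]; last by rewrite lee_fin.
apply: lime_le.
  by apply: is_cvg_nneseries => k _ _; rewrite lee_fin.
apply: nearW => n; under eq_bigr do rewrite arclength_gap_arc.
rewrite sumEFin lee_fin.
apply: (@le_trans _ _ (\sum_(0 <= k < (2 ^ n).-1) phi (g (lev k)))).
  by rewrite [leRHS](@big_cat_nat _ _ _ n)//= ?leq_pred_exp2// lerDl sumr_ge0.
rewrite (sum_lev (phi \o g)) (le_trans _ (phiM n))//.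
by apply: ler_sum => k _; rewrite -[leLHS]mulr_natl natrX.
Qed.
End CantorSet.

(** * The Cantor measure *)

Section CantorMeasure.
Variables (R : realType) (g : nat -> R).
Hypothesis g_gt0 : forall n, 0 < g n.
Hypothesis g_sum : series (fun n => 2 ^+ n * g n) @ \oo --> (1 : R).
Implicit Types (k n : nat).

Definition level_cover n : set (circle R) :=
  \bigcup_(k in [set k | lev k = n]) cell_arc g k.

Lemma measurable_cell_arc k : measurable (cell_arc g k).
Proof. by apply: closed_measurable_circle; exact: closed_closed_arc. Qed.

Lemma measurable_level_cover n : measurable (level_cover n).
Proof. by apply: bigcup_measurable => k _; exact: measurable_cell_arc. Qed.

(** The measure is the image of Lebesgue measure under the jump function. A point
    whose image lies in the arc of a cell belongs to the closed cell, a dyadic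
    interval of length 2 ^ - lev k, because the jump function is strictly
    increasing. *)
Lemma exists_cantor_measure : exists mu : probability (circle R) R,
  [/\ mu (~` cantor_set g) = 0%E,
      forall k, (mu (cell_arc g k) <= ((2 ^+ lev k)^-1)%:E)%E &
      forall n, mu (~` level_cover n) = 0%E].
Proof.
have ndj : {homo jump g : x y / x <= y} by move=> x y xy; exact: (jump_le g_gt0 g_sum xy).
have [mu muE] := exists_image_measure ndj.
have j01 x : 0 < x < 1 -> 0 < jump g x < 1.
  move=> /andP[x0 x1]; apply/andP; split.
    apply: le_lt_trans (jump_lt g_gt0 g_sum _ x0 (ltW x1)) => //.
    exact: jump_ge0 g_gt0 g_sum _.
  by apply: (lt_le_trans (jump_lt g_gt0 g_sum (ltW x0) x1 _)) => //; exact: jump_le1 g_gt0 g_sum _.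
exists mu; split.
- have [|_ ->] := muE (~` cantor_set g).
    apply: measurableC; apply: closed_measurable_circle.
    exact: closed_cantor_set g_gt0 g_sum.
  rewrite (_ : _ `&` _ = set0) ?measure0//; rewrite -subset0 => x [].
  rewrite /cantor_set setCK => -[k _ /= +]; rewrite in_itv/= => + x01.
  have /andP[jx0 jx1] := j01 x x01.
  move=> /arcE; rewrite (jump_left_ge0 g_gt0 g_sum) (jump_le1 g_gt0 g_sum).
  rewrite (ltW jx0) (ltW jx1) => /(_ isT isT isT) /andP[h1 h2].
  have := jump_notin_gap g_gt0 g_sum k x.
  by case; rewrite leNgt ?h1 ?h2.
- move=> k; have [|mB ->] := muE (cell_arc g k); first exact: measurable_cell_arc.
  rewrite -cell_size.
  have -> : (cell_r R k - cell_l R k)%:E = @lebesgue_measure R `[cell_l R k, cell_r R k]%classic.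
    rewrite lebesgue_measure_itv/= lte_fin (lt_trans (cell_l_dyad R k) (dyad_cell_r R k)).
    by rewrite EFinB.
  apply: le_measure; rewrite ?inE//.
  move=> x [[y /= +]]; rewrite !in_itv/= => y12 yx x01.
  have /andP[jx0 jx1] := j01 x x01.
  apply: (in_cell_of_jump g_gt0 g_sum).
  + by case/andP : x01 => /ltW.
  + by case/andP : x01 => _ /ltW.
  + suff -> : jump g x = y by [].
    apply: circle_exp_inj; first exact: j01.
      have /andP[y1 y2] := y12.
      rewrite (le_trans (jump_ge0 g_gt0 g_sum _) y1).
      by rewrite (le_trans y2)// (jump_left_le1 g_gt0 g_sum).
    by rewrite yx.
- move=> n; have [|_ ->] := muE (~` level_cover n).
    by apply: measurableC; exact: measurable_level_cover.
  rewrite (_ : _ `&` _ = set0) ?measure0//; rewrite -subset0 => x [/= nx].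
  rewrite in_itv/= => /andP[x0 x1]; apply: nx.
  have [k [kn k1 k2]] := cell_cover n (ltW x0) x1.
  exists k => //; exists (jump g x) => //=; rewrite in_itv/=.
  exact: (jump_in_cell g_gt0 g_sum k1 k2).
Qed.

Lemma level_cover_le (nu : {measure set (circle R) -> \bar R}) n A :
  measurable A -> nu (~` level_cover n) = 0%E ->
  (nu A <= \sum_((2 ^ n).-1 <= k < (2 ^ n.+1).-1) nu (A `&` cell_arc g k))%E.
Proof.
move=> mA nu0; have mU := measurable_level_cover n.
pose F k := if (k < (2 ^ n.+1).-1)%N then
  (if lev k == n then A `&` cell_arc g k else set0) else ~` level_cover n.
have mF k : measurable (F k).
  rewrite /F; case: ifP => _; last exact: measurableC.
  by case: ifP => _ //; apply: measurableI => //; exact: measurable_cell_arc.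
have sub : A `<=` \big[setU/set0]_(k < (2 ^ n.+1).-1.+1) F k.
  move=> xi Axi; rewrite -bigcup_mkord.
  have [[k /= kn ckx]|nU] := pselect (level_cover n xi).
    have kN : (k < (2 ^ n.+1).-1)%N.
      by have := lev_block n k; rewrite kn eqxx => /andP[].
    exists k => /=; first exact: ltnW.
    by rewrite /F kN kn eqxx.
  by exists (2 ^ n.+1).-1; [exact: ltnSn|rewrite /F ltnn].
have /le_trans : (nu A <= \sum_(k < (2 ^ n.+1).-1.+1) nu (F k))%E.
  apply: content_subadditive => //.
apply.
rewrite big_ord_recr/= {2}/F ltnn nu0 adde0.
rewrite -(big_mkord xpredT (fun k => nu (F k))) (@big_cat_nat _ _ _ (2 ^ n).-1)//=; last first.
  by rewrite pred_exp2S leq_addr.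
rewrite big_nat big1 ?add0e; last first.
  move=> k /andP[_ kn]; rewrite /F; case: ifPn => h.
    have := lev_block n k; rewrite leqNgt kn/= => /esym/negbT/negPf ->.
    exact: measure0.
  by exfalso; move/negP: h; apply; rewrite (leq_trans kn)// pred_exp2S leq_addr.
rewrite le_eqVlt; apply/orP; left; apply/eqP; apply: eq_big_nat => k kn.
by rewrite /F; move: kn (kn); rewrite {1}lev_block => -> /andP[_ ->].
Qed.

(** The cells of a late generation have less mass than A, and one of them meets A
    in positive mass. *)
Lemma nonatomic_of_small_cells (mu : {measure set (circle R) -> \bar R}) :
  (forall k, (mu (cell_arc g k) <= ((2 ^+ lev k)^-1)%:E)%E) ->
  (forall n, mu (~` level_cover n) = 0%E) -> nonatomic mu.
Proof.
move=> mus muc A mA A0.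
have [n nA] : exists n, (((2 ^+ n)^-1 : R)%:E < mu A)%E.
  case: (mu A) A0 => [a|_|//]; last by exists 0; rewrite ltry.
  rewrite lte_fin => a0; exists (Num.truncn a^-1).+1.
  rewrite lte_fin invf_plt ?posrE ?exprn_gt0//.
  apply: (lt_trans (truncnS_gt _)).
  by rewrite -natrX ltr_nat ltn_expl.
have [k [kn k0]] : exists k, lev k = n /\ (0 < mu (A `&` cell_arc g k))%E.
  apply: contrapT => hk.
  have := level_cover_le mA (muc n); rewrite leNgt => /negP; apply.
  rewrite big_nat big1// => k; rewrite lev_block => /eqP kn.
  apply/eqP; rewrite -measure_le0 leNgt; apply/negP => h; apply: hk.
  by exists k.
exists (A `&` cell_arc g k); split => //.
- by apply: measurableI => //; exact: measurable_cell_arc.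
- apply: le_lt_trans nA; rewrite -kn; apply: le_trans (mus k).
  by apply: le_measure; rewrite ?inE//; [apply: measurableI => //|]; exact: measurable_cell_arc.
Qed.
End CantorMeasure.

(** * Integrals of complex functions on the circle *)

Section ComplexIntegral.
Variable R : realType.
Implicit Types (xi : circle R) (f g : circle R -> R[i]).

Lemma measurable_continuous_circle (h : circle R -> R) :
  continuous h -> measurable_fun setT h.
Proof.
move=> ch; apply: (@measurability _ _ _ _ _ _ (@RGenOpens.G R)).
  exact: RGenOpens.measurableE.
move=> _ [A [a [b ->]] <-]; rewrite setTI; apply: open_measurable_circle.
by move/continuousP : ch; apply; exact: interval_open.
Qed.

Lemma compact_circle : compact [set: circle R].
Proof.
have -> : [set: circle R] = @circle_exp R @` `[0, 1].
  apply/seteqP; split => // xi _; have [x x01 <-] := circle_exp_surj xi.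
  by exists x => //=; rewrite in_itv.
apply: continuous_compact; last exact: segment_compact.
exact/continuous_subspaceT/continuous_circle_exp.
Qed.

Lemma integrable_continuous_circle (nu : {finite_measure set (circle R) -> \bar R})
  (h : circle R -> R) : continuous h -> nu.-integrable setT (EFin \o h).
Proof.
move=> ch; apply: measurable_bounded_integrable => //.
- by rewrite ltey_eq fin_num_measure.
- exact: measurable_continuous_circle.
- have : bounded_set (h @` setT).
    apply: compact_bounded; apply: continuous_compact; last exact: compact_circle.
    exact: continuous_subspaceT.
  move=> [M [Mr hM]]; exists M; split => // x Mx y _; apply: (hM x Mx).
  by exists y.
Qed.

(** Continuity of both coordinates, matching the componentwise definition of the
    integral. *)
Definition ccontinuous f :=
  continuous (fun xi => complex.Re (f xi)) /\ continuous (fun xi => complex.Im (f xi)).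

Lemma ccontinuous_cst (c : R[i]) : ccontinuous (fun=> c).
Proof. by split; exact: cst_continuous. Qed.

Lemma ccontinuous_circle_val : ccontinuous (@circle_val R).
Proof. by split; [exact: continuous_re_circ|exact: continuous_im_circ]. Qed.

Lemma eq_continuous_circle (h k : circle R -> R) : h =1 k -> continuous k -> continuous h.
Proof. by move=> /funext ->. Qed.

Lemma continuous_addfun (h k : circle R -> R) :
  continuous h -> continuous k -> continuous (fun xi => h xi + k xi).
Proof. by move=> ch ck x; exact: (@continuousD R R^o _ h k x (ch x) (ck x)). Qed.

Lemma continuous_mulfun (h k : circle R -> R) :
  continuous h -> continuous k -> continuous (fun xi => h xi * k xi).
Proof. by move=> ch ck x; exact: (@continuousM R _ h k x (ch x) (ck x)). Qed.

Lemma continuous_oppfun (h : circle R -> R) : continuous h -> continuous (fun xi => - h xi).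
Proof. by move=> ch x; exact: (@continuousN R R^o _ h x (ch x)). Qed.

Lemma continuous_subfun (h k : circle R -> R) :
  continuous h -> continuous k -> continuous (fun xi => h xi - k xi).
Proof. by move=> ch ck; apply: continuous_addfun => //; exact: continuous_oppfun. Qed.

Lemma continuous_invfun (h : circle R -> R) : (forall xi, h xi != 0) ->
  continuous h -> continuous (fun xi => (h xi)^-1).
Proof. by move=> h0 ch x; exact: (continuousV (h0 x) (ch x)). Qed.

Lemma ccontinuousD f g : ccontinuous f -> ccontinuous g -> ccontinuous (fun xi => f xi + g xi).
Proof.
move=> [f1 f2] [g1 g2]; split; (apply: eq_continuous_circle; first by move=> xi; exact: raddfD).
  exact: continuous_addfun.
exact: continuous_addfun.
Qed.

Lemma Re_mulc (z w : R[i]) : complex.Re (z * w) =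
  complex.Re z * complex.Re w - complex.Im z * complex.Im w.
Proof. by case: z; case: w. Qed.

Lemma Im_mulc (z w : R[i]) : complex.Im (z * w) =
  complex.Re z * complex.Im w + complex.Im z * complex.Re w.
Proof. by case: z; case: w. Qed.

Lemma ccontinuousM f g : ccontinuous f -> ccontinuous g -> ccontinuous (fun xi => f xi * g xi).
Proof.
move=> [f1 f2] [g1 g2]; split.
  apply: eq_continuous_circle; first by move=> xi; exact: Re_mulc.
  by apply: continuous_subfun; exact: continuous_mulfun.
apply: eq_continuous_circle; first by move=> xi; exact: Im_mulc.
by apply: continuous_addfun; exact: continuous_mulfun.
Qed.

Definition sqrnormc (z : R[i]) : R := complex.Re z ^+ 2 + complex.Im z ^+ 2.

Lemma sqrnormcE z : sqrnormc z = Normc.normc z ^+ 2.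
Proof.
by case: z => a b; rewrite /sqrnormc/= sqr_sqrtr// addr_ge0// sqr_ge0.
Qed.

Lemma sqrnormc_eq0 z : (sqrnormc z == 0) = (z == 0).
Proof.
by rewrite sqrnormcE sqrf_eq0; apply/eqP/eqP => [/Normc.eq0_normc//|->]; rewrite Normc.normc0.
Qed.

Lemma Re_invc (z : R[i]) : complex.Re z^-1 = complex.Re z * (sqrnormc z)^-1.
Proof. by case: z. Qed.

Lemma Im_invc (z : R[i]) : complex.Im z^-1 = - complex.Im z * (sqrnormc z)^-1.
Proof. by case: z => a b /=; rewrite mulNr. Qed.

Lemma continuous_sqrnormc f : ccontinuous f -> continuous (fun xi => sqrnormc (f xi)).
Proof.
by move=> [f1 f2]; apply: continuous_addfun; exact: continuous_mulfun.
Qed.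

Lemma ccontinuousV f : ccontinuous f -> (forall xi, f xi != 0) ->
  ccontinuous (fun xi => (f xi)^-1).
Proof.
move=> cf f0; have [f1 f2] := cf.
have cn : continuous (fun xi => (sqrnormc (f xi))^-1).
  apply: continuous_invfun; last exact: continuous_sqrnormc.
  by move=> xi; rewrite sqrnormc_eq0.
split.
  apply: eq_continuous_circle; first by move=> xi; exact: Re_invc.
  exact: continuous_mulfun.
apply: eq_continuous_circle; first by move=> xi; exact: Im_invc.
by apply: continuous_mulfun => //; exact: continuous_oppfun.
Qed.

Variable nu : {finite_measure set (circle R) -> \bar R}.

Lemma Re_cintegral f :
  complex.Re (cintegral nu f) = Rintegral nu setT (fun xi => complex.Re (f xi)).
Proof. by []. Qed.

Lemma complex_ext (z w : R[i]) :
  complex.Re z = complex.Re w -> complex.Im z = complex.Im w -> z = w.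
Proof. by case: z; case: w => a b c d /= -> ->. Qed.

Lemma cintegralD f g : ccontinuous f -> ccontinuous g ->
  cintegral nu (fun xi => f xi + g xi) = cintegral nu f + cintegral nu g.
Proof.
move=> [f1 f2] [g1 g2]; apply: complex_ext; rewrite raddfD/=.
  rewrite -RintegralD//; try exact: integrable_continuous_circle.
  by apply: eq_Rintegral => xi _; rewrite raddfD.
rewrite -RintegralD//; try exact: integrable_continuous_circle.
by apply: eq_Rintegral => xi _; rewrite raddfD.
Qed.

Lemma cintegralZ c f : ccontinuous f ->
  cintegral nu (fun xi => c * f xi) = c * cintegral nu f.
Proof.
move=> [f1 f2].
have i1 := integrable_continuous_circle nu f1.
have i2 := integrable_continuous_circle nu f2.
have i3 (r : R) (h : circle R -> R) : continuous h -> nu.-integrable setT (EFin \o (fun x => r * h x)).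
  move=> ch; apply: integrable_continuous_circle; apply: continuous_mulfun => //.
  exact: cst_continuous.
apply: complex_ext; rewrite ?Re_mulc ?Im_mulc/=.
  rewrite -!RintegralZl// -RintegralB//; try exact: i3.
  by apply: eq_Rintegral => xi _; rewrite Re_mulc.
rewrite -!RintegralZl// -RintegralD//; try exact: i3.
by apply: eq_Rintegral => xi _; rewrite Im_mulc.
Qed.

Lemma normr_Rintegral_le (h : circle R -> R) (M : R) : continuous h -> (forall xi, `|h xi| <= M) ->
  `|Rintegral nu setT h| <= M * fine (nu setT).
Proof.
move=> ch hM; apply: le_trans (le_normr_Rintegral _ _) _ => //.
  exact: integrable_continuous_circle.
rewrite -Rintegral_cst//; apply: le_Rintegral => //.
- apply: integrable_continuous_circle => x.
  by apply: (@continuous_comp _ _ _ h Num.norm); [exact: ch|exact: norm_continuous].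
- by apply: integrable_continuous_circle; exact: cst_continuous.
Qed.

Lemma normc_le_ReIm (z : R[i]) : Normc.normc z <= `|complex.Re z| + `|complex.Im z|.
Proof.
case: z => a b /=; rewrite -(@ler_pXn2r _ 2) ?nnegrE ?sqrtr_ge0 ?addr_ge0//.
rewrite sqr_sqrtr ?addr_ge0 ?sqr_ge0// sqrrD !real_normK ?num_real//.
by rewrite lerD2r lerDl mulrn_wge0// mulr_ge0.
Qed.

Lemma normc_cintegral_le f (M : R) : ccontinuous f -> (forall xi, Normc.normc (f xi) <= M) ->
  Normc.normc (cintegral nu f) <= 2 * M * fine (nu setT).
Proof.
move=> [f1 f2] fM; apply: le_trans (normc_le_ReIm _) _ => /=.
rewrite mulr_natl mulr2n mulrDl; apply: lerD; apply: normr_Rintegral_le => // xi.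
  exact: le_trans (normc_Re _) (fM xi).
exact: le_trans (normc_Im _) (fM xi).
Qed.
End ComplexIntegral.

(** * The complex exponential and difference quotients *)

Section ComplexExp.
Variable R : realType.
Implicit Types (z w k h L : R[i]).
Local Notation N := (@Normc.normc R).

Lemma normc_ge0 z : 0 <= N z.
Proof. by case: z => a b; exact: sqrtr_ge0. Qed.

Lemma normc_triangle z w : N (z + w) <= N z + N w.
Proof. exact: (@le_normcD R z w). Qed.

Lemma normc_opp z : N (- z) = N z.
Proof. exact: (@normcN R z). Qed.

Lemma normc_real (r : R) : N r%:C = `|r|.
Proof. by rewrite /= expr0n/= addr0 sqrtr_sqr. Qed.

Lemma normcE' z : `|z| = (N z)%:C.
Proof. by case: z. Qed.

Lemma cexpD z w : cexp (z + w) = cexp z * cexp w.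
Proof.
rewrite /cexp; case: z => a b; case: w => c d; apply: complex_ext => /=.
  by rewrite expRD cosD; ring.
by rewrite expRD sinD; ring.
Qed.

Lemma normc_cexp z : N (cexp z) = expR (complex.Re z).
Proof.
by rewrite /cexp/= !exprMn -mulrDr cos2Dsin2 mulr1 sqrtr_sqr ger0_norm//.
Qed.

Lemma expR_quadratic (a : R) : `|a| <= 1 / 2 -> 0 <= expR a - 1 - a <= 2 * a ^+ 2.
Proof.
rewrite ler_norml => /andP[a1 a2].
have h1 := expR_ge1Dx a; have h2 := expR_ge1Dx (- a).
have e0 := expR_gt0 a.
have h3 : expR a * (1 - a) <= 1.
  by rewrite -[leRHS](mulfV (lt0r_neq0 e0)) -expRN ler_wpM2l// ltW.
apply/andP; split; first lra.
have : expR a <= 1 + a + 2 * a ^+ 2.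
  rewrite -(@ler_pM2r _ (1 - a)); last lra.
  apply: (le_trans h3); nra.
lra.
Qed.

Lemma cos_quadratic (b : R) : `|cos b - 1| <= b ^+ 2 / 2.
Proof.
have := sin_half_sqr (b / 2); have := sin_sqr_le (b / 2).
rewrite (_ : 2 * (b / 2) = b); last by field.
have := cos_le1 b; move=> c1 h1 h2; rewrite ler0_norm; lra.
Qed.

Lemma sin_cubic (b : R) : `|sin b - b| <= `|b| ^+ 3.
Proof.
wlog b0 : b / 0 <= b.
  move=> H; have [|b0] := leP 0 b; first exact: H.
  have := H (- b); rewrite sinN normrN -opprD normrN; apply.
  by rewrite oppr_ge0 ltW.
have [c] := @MVT_segment R sin cos 0 b b0 (fun y _ => is_derive_sin y)
  (continuous_subspaceT (@continuous_sin R)).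
rewrite in_itv/= => /andP[c0 cb]; rewrite sin0 !subr0 => ->.
rewrite -{2}[b]mul1r -mulrBl normrM exprSr ler_wpM2r//.
apply: (le_trans (cos_quadratic c)); rewrite (ger0_norm b0).
have : c ^+ 2 <= b ^+ 2 by rewrite ler_pXn2r.
have := sqr_ge0 c; lra.
Qed.

(** The coordinates are expanded to first order; the constant 8 absorbs the
    quadratic errors of exp, cos and sin. *)
Lemma cexp_quadratic k : N k <= 1 / 2 -> N (cexp k - 1 - k) <= 8 * N k ^+ 2.
Proof.
move=> k12; apply: le_trans (normc_le_ReIm _) _.
have := normc_Re k; have := normc_Im k; move: k12.
rewrite -sqrnormcE /sqrnormc /cexp.
move: (N k) => n; case: k => a b /= n12 bn an.
have a12 := le_trans an n12; have b12 := le_trans bn n12.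
have /andP[e1 e2] := expR_quadratic a12.
have c1 := cos_quadratic b; have s1 := sin_cubic b.
have a2 : a ^+ 2 = `|a| ^+ 2 by rewrite real_normK ?num_real.
have b2 : b ^+ 2 = `|b| ^+ 2 by rewrite real_normK ?num_real.
have A0 := normr_ge0 a; have B0 := normr_ge0 b.
have ea : expR a <= 2.
  by have := ler_norm a; rewrite a2 in e2; nra.
have ea0 := expR_gt0 a.
have R1 : `|expR a * cos b - 1 - a| <= b ^+ 2 + 2 * a ^+ 2.
  have -> : expR a * cos b - 1 - a = expR a * (cos b - 1) + (expR a - 1 - a) by ring.
  apply: (le_trans (ler_normD _ _)); rewrite normrM (gtr0_norm ea0).
  apply: lerD; last by rewrite ger0_norm.
  apply: (@le_trans _ _ (2 * (b ^+ 2 / 2))); last by lra.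
  by apply: ler_pM => //; exact: ltW.
have R2 : `|expR a * sin b - 0 - b| <= 2 * a ^+ 2 + 3 * b ^+ 2.
  have -> : expR a * sin b - 0 - b = expR a * (sin b - b) + (expR a - 1 - a) * b + a * b by ring.
  apply: (le_trans (ler_normD _ _)); apply: (le_trans (lerD (ler_normD _ _) (lexx _))).
  rewrite !normrM (gtr0_norm ea0) (ger0_norm e1).
  have h1 : expR a * `|sin b - b| <= 2 * `|b| ^+ 3.
    by apply: ler_pM => //; exact: ltW.
  have h2 : (expR a - 1 - a) * `|b| <= 2 * a ^+ 2 * `|b| by rewrite ler_wpM2r.
  have h3 : `|b| ^+ 3 <= `|b| ^+ 2 * (1 / 2) by rewrite exprSr ler_wpM2l ?exprn_ge0.
  have h4 : a ^+ 2 * `|b| <= a ^+ 2 * (1 / 2) by rewrite ler_wpM2l ?sqr_ge0.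
  have h5 : `|a| * `|b| <= (a ^+ 2 + b ^+ 2) / 2.
    by rewrite a2 b2; have := sqr_ge0 (`|a| - `|b|); nra.
  rewrite -b2 in h3; have := sqr_ge0 a; have := sqr_ge0 b; lra.
have := sqr_ge0 a; have := sqr_ge0 b; lra.
Qed.

(** A linear rate for the difference quotients gives their limit. *)
Lemma derive1_quadratic (f : R[i]^o -> R[i]^o) (z L : R[i]^o) (C d : R) : 0 < d ->
  (forall h, h != 0 -> N h < d -> N (h^-1 * (f (h + z) - f z) - L) <= C * N h) ->
  derive1 f z = L.
Proof.
move=> d0 H; rewrite /derive1; apply: cvg_lim; first exact: norm_hausdorff.
apply/cvgrPdist_lt => /= -[e e'].
rewrite ltcE/= => /andP[/eqP ->{e'} e0].
pose C' := `|C| + 1.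
have C0 : 0 < C' by rewrite /C'; have := normr_ge0 C; lra.
pose dl := Num.min d (e / C').
have dl0 : 0 < dl by rewrite lt_min d0 divr_gt0.
apply/nbhs_ballP; exists (dl%:C : R[i]); first by rewrite /= ltcR.
move=> h; rewrite -ball_normE /= sub0r normrN normcE' ltcR lt_min => /andP[hd he] h0.
rewrite -normrN opprB normcE' ltcR.
apply: (le_lt_trans (H h h0 hd)).
apply: (@le_lt_trans _ _ (`|C| * N h)).
  by rewrite ler_wpM2r ?normc_ge0// ler_norm.
have := normc_ge0 h; move: he; rewrite ltr_pdivlMr// /C'; nra.
Qed.
End ComplexExp.

(** * The derivative of a singular inner function *)

Section SingularInner.
Variable R : realType.
Variable nu : {finite_measure set (circle R) -> \bar R}.
Implicit Types (z h : R[i]) (xi zeta : circle R).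
Local Notation N := (@Normc.normc R).
Local Notation m := (fine (nu setT)).

Let m_ge0 : 0 <= m. Proof. by rewrite fine_ge0. Qed.

Definition herglotz z : R[i] :=
  cintegral nu (fun xi => (circle_val xi + z) / (circle_val xi - z)).

(** The kernel 2 xi / (xi - z) ^ 2 is the derivative in z of the kernel
    (xi + z) / (xi - z). *)
Definition herglotz' z : R[i] :=
  cintegral nu (fun xi => 2 * circle_val xi * ((circle_val xi - z)^-1 * (circle_val xi - z)^-1)).

Lemma normc_circle_val xi : N (circle_val xi) = 1.
Proof.
have := circleE xi; rewrite /re_circ /im_circ; case: (circle_val xi) => a b /= ->.
exact: sqrtr1.
Qed.

Lemma normc_sub_circle xi z : 1 - N z <= N (circle_val xi - z).
Proof.
rewrite lerBlDr -(normc_circle_val xi).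
by apply: le_trans (normc_triangle _ _); rewrite subrK.
Qed.

Lemma normc_neq0 z : 0 < N z -> z != 0.
Proof. by apply: contraTneq => ->; rewrite Normc.normc0 ltxx. Qed.

Lemma sub_circle_neq0 xi z : N z < 1 -> circle_val xi - z != 0.
Proof.
move=> z1; apply: normc_neq0; apply: lt_le_trans (normc_sub_circle xi z); lra.
Qed.

Lemma ccontinuous_sub z : ccontinuous (fun xi => circle_val xi - z).
Proof. by apply: ccontinuousD; [exact: ccontinuous_circle_val|exact: ccontinuous_cst]. Qed.

Lemma ccontinuous_herglotz z : N z < 1 ->
  ccontinuous (fun xi => (circle_val xi + z) / (circle_val xi - z)).
Proof.
move=> z1; apply: ccontinuousM.
  by apply: ccontinuousD; [exact: ccontinuous_circle_val|exact: ccontinuous_cst].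
apply: ccontinuousV; first exact: ccontinuous_sub.
by move=> xi; exact: sub_circle_neq0.
Qed.

Lemma ccontinuous_herglotz' z : N z < 1 ->
  ccontinuous (fun xi => 2 * circle_val xi * ((circle_val xi - z)^-1 * (circle_val xi - z)^-1)).
Proof.
move=> z1.
have cV : ccontinuous (fun xi => (circle_val xi - z)^-1).
  apply: ccontinuousV; first exact: ccontinuous_sub.
  by move=> xi; exact: sub_circle_neq0.
apply: ccontinuousM; last exact: ccontinuousM.
by apply: ccontinuousM; [exact: ccontinuous_cst|exact: ccontinuous_circle_val].
Qed.

Lemma normc2 : N 2 = 2.
Proof. by rewrite /Normc.normc/= addr0 expr0n/= addr0 sqrtr_sqr ger0_norm. Qed.

(** The remainder of the kernel is exactly
    2 xi h ^ 2 / ((xi - z - h) (xi - z) ^ 2), and |xi - z| >= 1 - |z|. *)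
Lemma herglotz_taylor z h : N z < 1 -> N h <= (1 - N z) / 2 ->
  N (herglotz (h + z) - herglotz z - h * herglotz' z) <=
  8 / (1 - N z) ^+ 3 * m * N h ^+ 2.
Proof.
move=> z1 hz; set d := 1 - N z; have d0 : 0 < d by rewrite subr_gt0.
have hz1 : N (h + z) < 1.
  by apply: (le_lt_trans (normc_triangle _ _)); rewrite /d in d0 *; lra.
have c1 := ccontinuous_herglotz hz1; have c2 := ccontinuous_herglotz z1.
have c3 := ccontinuous_herglotz' z1.
have -> : herglotz (h + z) - herglotz z - h * herglotz' z =
  cintegral nu (fun xi =>
    (circle_val xi + (h + z)) / (circle_val xi - (h + z)) +
    (-1) * ((circle_val xi + z) / (circle_val xi - z)) +
    (- h) * (2 * circle_val xi * ((circle_val xi - z)^-1 * (circle_val xi - z)^-1))).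
  have cz (c : R[i]) f : ccontinuous f -> ccontinuous (fun xi => c * f xi).
    by move=> cf; apply: ccontinuousM => //; exact: ccontinuous_cst.
  rewrite cintegralD; [|by apply: ccontinuousD => //; exact: cz|exact: cz].
  rewrite cintegralD//; last exact: cz.
  by rewrite !cintegralZ// mulN1r mulNr.
have -> : 8 / d ^+ 3 * m * N h ^+ 2 = 2 * (4 / d ^+ 3 * N h ^+ 2) * m by ring.
apply: normc_cintegral_le.
  apply: ccontinuousD; last by apply: ccontinuousM => //; exact: ccontinuous_cst.
  by apply: ccontinuousD => //; apply: ccontinuousM => //; exact: ccontinuous_cst.
move=> xi; set x := circle_val xi.
have u0 : x - z != 0 by exact: sub_circle_neq0.
have v0 : x - (h + z) != 0 by exact: sub_circle_neq0.
have -> : (x + (h + z)) / (x - (h + z)) + -1 * ((x + z) / (x - z)) +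
    - h * (2 * x * ((x - z)^-1 * (x - z)^-1)) =
  2 * x * (h * h) * ((x - (h + z))^-1 * ((x - z)^-1 * (x - z)^-1)).
  by field; rewrite u0 v0.
rewrite !Normc.normcM !Normc.normcV normc2 normc_circle_val mulr1.
have nu1 : d <= N (x - z) by exact: normc_sub_circle.
have nv1 : d / 2 <= N (x - (h + z)).
  apply: le_trans (normc_sub_circle xi (h + z)).
  have := normc_triangle h z; rewrite /d in hz *; lra.
have -> : 4 / d ^+ 3 * N h ^+ 2 = 2 * (N h * N h) * ((d / 2)^-1 * (d^-1 * d^-1)).
  by field; rewrite gt_eqF.
rewrite ler_wpM2l ?mulr_ge0 ?normc_ge0//.
have i1 : (N (x - z))^-1 <= d^-1 by rewrite lef_pV2 ?posrE// (lt_le_trans d0).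
have d20 : 0 < d / 2 by rewrite divr_gt0.
have i2 : (N (x - (h + z)))^-1 <= (d / 2)^-1.
  by rewrite lef_pV2 ?posrE// (lt_le_trans d20).
by rewrite !ler_pM// ?mulr_ge0 ?invr_ge0 ?normc_ge0.
Qed.

Lemma singular_innerE z : singular_inner nu z = cexp (- herglotz z).
Proof. by []. Qed.

Lemma derive1_singular_inner (z : R[i]^o) : N z < 1 ->
  derive1 (singular_inner nu) z = - (singular_inner nu z * herglotz' z).
Proof.
move=> z1; set d := 1 - N z; have d0 : 0 < d by rewrite subr_gt0.
set c := 8 / d ^+ 3 * m.
have c0 : 0 <= c by rewrite mulr_ge0// divr_ge0// exprn_ge0// ltW.
set M := N (herglotz' z) + c.
have M0 : 0 <= M by rewrite addr_ge0// normc_ge0.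
pose d1 := Num.min (d / 2) (Num.min 1 (1 / (2 * (M + 1)))).
have d10 : 0 < d1.
  have e1 : 0 < d / 2 by rewrite divr_gt0.
  have e2 : 0 < 1 / (2 * (M + 1)) by rewrite divr_gt0// mulr_gt0// ltr_wpDl.
  by rewrite !lt_min e1 ltr01 e2.
apply: (@derive1_quadratic _ _ z _ (N (singular_inner nu z) * (8 * M ^+ 2 + c)) d1) => // h h0.
rewrite !lt_min => /and3P[hd h1 hM].
pose rho := herglotz (h + z) - herglotz z - h * herglotz' z.
have rhole : N rho <= c * N h ^+ 2 by apply: herglotz_taylor => //; exact: ltW.
(* the increment of the exponent, so that S (h + z) = S z * cexp k *)
pose k := - (h * herglotz' z + rho).
have Nh0 : 0 <= N h by exact: normc_ge0.
have Nhp : 0 < N h.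
  rewrite lt_neqAle Nh0 andbT eq_sym; apply: contra h0 => /eqP/Normc.eq0_normc -> //.
have kle : N k <= M * N h.
  rewrite /k normc_opp; apply: (le_trans (normc_triangle _ _)).
  rewrite Normc.normcM /M mulrDl mulrC lerD2l (le_trans rhole)//.
  by rewrite ler_wpM2l// expr2 ler_piMl// ltW.
have k12 : N k <= 1 / 2.
  apply: (le_trans kle); move: hM; rewrite ltr_pdivlMr; last by rewrite mulr_gt0//; lra.
  nra.
have SE : singular_inner nu (h + z) = singular_inner nu z * cexp k.
  rewrite !singular_innerE -cexpD; congr cexp; rewrite /k /rho; ring.
have -> : h^-1 * (singular_inner nu (h + z) - singular_inner nu z) -
    - (singular_inner nu z * herglotz' z) =
    singular_inner nu z * (h^-1 * ((cexp k - 1 - k) - rho)).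
  rewrite SE; have -> : rho = - k - h * herglotz' z by rewrite /k; ring.
  by field.
rewrite Normc.normcM -mulrA ler_wpM2l ?normc_ge0//.
rewrite Normc.normcM Normc.normcV ler_pdivrMl// .
apply: (le_trans (normc_triangle _ _)); rewrite normc_opp.
have q := cexp_quadratic k12.
have kk : N k ^+ 2 <= (M * N h) ^+ 2.
  by rewrite ler_pXn2r ?nnegrE ?mulr_ge0 ?normc_ge0.
have -> : N h * ((8 * M ^+ 2 + c) * N h) = 8 * (M * N h) ^+ 2 + c * N h ^+ 2 by ring.
lra.
Qed.
End SingularInner.

(** * A lower bound for the derivative *)

Section LowerBound.
Variable R : realType.
Variable nu : {finite_measure set (circle R) -> \bar R}.
Implicit Types (xi zeta : circle R).
Local Notation N := (@Normc.normc R).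
Local Notation m := (fine (nu setT)).

Lemma Rintegral_null_compl (E : set (circle R)) (h : circle R -> R) : measurable E ->
  nu (~` E) = 0%E -> continuous h -> Rintegral nu setT h = Rintegral nu E h.
Proof.
move=> mE E0 ch; have ih := integrable_continuous_circle nu ch.
rewrite -(setUv E) Rintegral_setU//; last 3 first.
- exact: measurableC.
- by rewrite setUv.
- by apply/disj_setPS => x [].
rewrite [X in _ + X](_ : _ = 0) ?addr0// /Rintegral.
rewrite null_set_integral//.
- exact: measurableC.
- by apply: measurable_funTS; exact: measurable_int ih.
Qed.

Lemma le_Rintegral_null_compl (E : set (circle R)) (h k : circle R -> R) : measurable E ->
  nu (~` E) = 0%E -> continuous h -> continuous k -> (forall xi, E xi -> h xi <= k xi) ->
  Rintegral nu setT h <= Rintegral nu setT k.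
Proof.
move=> mE E0 ch ck hk; rewrite !(Rintegral_null_compl mE E0)//.
have iE (f : circle R -> R) : continuous f -> nu.-integrable E (EFin \o f).
  move=> cf; apply: (integrableS measurableT mE) => //.
  exact: integrable_continuous_circle.
by apply: le_Rintegral => //; exact: iE.
Qed.

Lemma Rintegral_ge_measure (P : set (circle R)) (h : circle R -> R) (c : R) : measurable P ->
  continuous h -> (forall xi, 0 <= h xi) -> (forall xi, P xi -> c <= h xi) ->
  c * fine (nu P) <= Rintegral nu setT h.
Proof.
move=> mP ch h0 hc; have ih := integrable_continuous_circle nu ch.
rewrite -(setUv P) Rintegral_setU//; last 3 first.
- exact: measurableC.
- by rewrite setUv.
- by apply/disj_setPS => x [].
rewrite -[leLHS]addr0; apply: lerD; last exact: Rintegral_ge0.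
rewrite -Rintegral_cst//; apply: le_Rintegral => //.
- apply: (integrableS measurableT mP) => //.
  by apply: integrable_continuous_circle; exact: cst_continuous.
- exact: (integrableS measurableT mP).
Qed.

Variables (zeta : circle R) (r : R).
Hypothesis r_gt0 : 0 < r.
Hypothesis r_lt1 : r < 1.
Local Notation z := (r%:C * circle_val zeta).

(** The squared distance from xi to r zeta, written through the chord from xi to
    zeta. *)
Definition dist2 xi : R := (1 - r) ^+ 2 + r * chord2 xi zeta.

Lemma normc_radial : N z = r.
Proof. by rewrite Normc.normcM normc_circle_val mulr1 normc_real gtr0_norm. Qed.

Let z_lt1 : N z < 1. Proof. by rewrite normc_radial. Qed.

Lemma dist2E xi : sqrnormc (circle_val xi - z) = dist2 xi.
Proof.
have := circleE xi; have := circleE zeta.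
rewrite /sqrnormc /dist2 /chord2 /re_circ /im_circ !raddfB/= Re_mulc Im_mulc/=.
rewrite !mul0r subr0 addr0.
move: (complex.Re (circle_val xi)) (complex.Im (circle_val xi)) => a b.
move: (complex.Re (circle_val zeta)) (complex.Im (circle_val zeta)) => c d h1 h2.
have -> : (a - r * c) ^+ 2 + (b - r * d) ^+ 2 =
  (a ^+ 2 + b ^+ 2) + r ^+ 2 * (c ^+ 2 + d ^+ 2) - 2 * r * (a * c + b * d) by ring.
have -> : (a - c) ^+ 2 + (b - d) ^+ 2 =
  (a ^+ 2 + b ^+ 2) + (c ^+ 2 + d ^+ 2) - 2 * (a * c + b * d) by ring.
by rewrite h1 h2; ring.
Qed.

Lemma dist2_gt0 xi : 0 < dist2 xi.
Proof.
rewrite -dist2E lt_neqAle eq_sym sqrnormc_eq0 sub_circle_neq0//= sqrnormcE.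
exact: sqr_ge0.
Qed.

Lemma continuous_dist2 : continuous dist2.
Proof.
have -> : dist2 = (fun xi => sqrnormc (circle_val xi - z)).
  by apply/funext => xi; rewrite dist2E.
by apply: continuous_sqrnormc; exact: ccontinuous_sub.
Qed.

(** The Poisson kernel. *)
Lemma Re_herglotz_kernel xi :
  complex.Re ((circle_val xi + z) / (circle_val xi - z)) = (1 - r ^+ 2) / dist2 xi.
Proof.
rewrite Re_mulc Re_invc Im_invc dist2E !mulNr mulrN opprK !mulrA -mulrDl; congr (_ / _).
have := circleE xi; have := circleE zeta.
rewrite !raddfD !raddfN/= Re_mulc Im_mulc /re_circ /im_circ/=.
move: (complex.Re (circle_val xi)) (complex.Im (circle_val xi)) => a b.
move: (complex.Re (circle_val zeta)) (complex.Im (circle_val zeta)) => c d h1 h2.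
rewrite -[1 in RHS]h2 -[r ^+ 2]mulr1 -h1; ring.
Qed.

(** With w = z / xi the left-hand side is minus the real part of twice the Koebe
    function w / (1 - w) ^ 2, and |1 - w| ^ 2 is dist2 xi. For r = 1 it reduces to
    2 / dist2 xi. *)
Lemma Re_herglotz'_kernel xi :
  complex.Re (- z * (2 * circle_val xi * ((circle_val xi - z)^-1 * (circle_val xi - z)^-1))) =
  ((1 + r ^+ 2) * dist2 xi - (1 - r ^+ 2) ^+ 2) / dist2 xi ^+ 2.
Proof.
have d0 : dist2 xi != 0 by rewrite gt_eqF ?dist2_gt0.
have dE := dist2E xi; have := circleE xi; have := circleE zeta; move: dE d0.
rewrite !(Re_mulc, Im_mulc, Re_invc, Im_invc) => dE; rewrite dE; move: dE.
rewrite /sqrnormc !raddfB !raddfN/= !Re_mulc !Im_mulc /re_circ /im_circ/=.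
move: (dist2 xi) => D.
move: (complex.Re (circle_val xi)) (complex.Im (circle_val xi)) => a b.
move: (complex.Re (circle_val zeta)) (complex.Im (circle_val zeta)) => c d DE D0 h1 h2.
transitivity (- 2 * (r * (a * c + b * d) * ((a ^+ 2 + b ^+ 2) + r ^+ 2 * (c ^+ 2 + d ^+ 2))
   - 2 * r ^+ 2 * (a ^+ 2 + b ^+ 2) * (c ^+ 2 + d ^+ 2)) / D ^+ 2).
  by field.
congr (_ / _); rewrite h1 h2.
have <- : 1 + r ^+ 2 - 2 * (r * (a * c + b * d)) = D.
  rewrite -DE.
  transitivity (a ^+ 2 + b ^+ 2 + r ^+ 2 * (c ^+ 2 + d ^+ 2) - 2 * (r * (a * c + b * d))); last by ring.
  by rewrite h1 h2; ring.
by ring.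
Qed.

(** Here |S'| = |S| |herglotz'|. The Poisson integral of nu at r zeta is at most 1,
    which gives |S| >= 1 / e. Since |r zeta| <= 1, the second factor is at least the
    real part of - r zeta * herglotz', whose integrand is on E at least
    1 / (2 dist2): near the circle, off the support, the kernel no longer
    oscillates. *)
Lemma derive1_lower_bound (E P : set (circle R)) (delta Delta : R) :
  measurable E -> nu (~` E) = 0%E -> 0 < delta ->
  (forall xi, E xi -> delta <= dist2 xi) ->
  (1 - r ^+ 2) * m <= delta -> (1 - r ^+ 2) ^+ 2 <= delta / 2 ->
  measurable P -> (forall xi, P xi -> dist2 xi <= Delta) -> 0 < Delta ->
  expR (-1) * ((2 * Delta)^-1 * fine (nu P)) <=
  N (derive1 (singular_inner nu) z).
Proof.
move=> mE E0 d0 dE dm dd mP PD D0.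
have r2 : 0 <= 1 - r ^+ 2 by rewrite subr_ge0 expr_le1// ltW.
have cVd : continuous (fun xi => (dist2 xi)^-1).
  apply: continuous_invfun; last exact: continuous_dist2.
  by move=> xi; rewrite gt_eqF ?dist2_gt0.
have cst c : continuous (fun _ : circle R => c : R) by exact: cst_continuous.
rewrite derive1_singular_inner// normc_opp Normc.normcM.
apply: ler_pM.
- exact: expR_ge0.
- by rewrite mulr_ge0 ?invr_ge0 ?mulr_ge0 ?(ltW D0)// fine_ge0.
- rewrite singular_innerE normc_cexp ler_expR raddfN/= lerN2.
  rewrite /herglotz/=; under eq_Rintegral do rewrite Re_herglotz_kernel.
  apply: (@le_trans _ _ (Rintegral nu setT (fun=> (1 - r ^+ 2) / delta))).
    apply: (le_Rintegral_null_compl mE E0) => //.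
      exact: continuous_mulfun.
    move=> xi /dE h; rewrite ler_wpM2l// lef_pV2 ?posrE//.
    exact: lt_le_trans h.
  by rewrite Rintegral_cst// mulrAC ler_pdivrMr// mul1r.
- have zle : N (- z * herglotz' nu z) <= N (herglotz' nu z).
    by rewrite Normc.normcM normc_opp normc_radial ler_piMl ?normc_ge0// ltW.
  apply: le_trans zle; apply: le_trans (le_trans (ler_norm _) (normc_Re _)).
  rewrite /herglotz' -cintegralZ; last exact: ccontinuous_herglotz'.
  rewrite Re_cintegral; under eq_Rintegral do rewrite Re_herglotz'_kernel.
  apply: (@le_trans _ _ (Rintegral nu setT (fun xi => 2^-1 * (dist2 xi)^-1))).
    apply: Rintegral_ge_measure => //.
    + exact: continuous_mulfun.
    + by move=> xi; rewrite mulr_ge0 ?invr_ge0// ltW ?dist2_gt0.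
    + move=> xi /PD h; rewrite invfM ler_wpM2l// ?invr_ge0//.
      by rewrite lef_pV2 ?posrE// dist2_gt0.
  apply: (le_Rintegral_null_compl mE E0).
  + exact: continuous_mulfun.
  + apply: continuous_mulfun.
      apply: continuous_subfun => //; apply: continuous_mulfun => //.
      exact: continuous_dist2.
    apply: continuous_invfun; first by move=> xi; rewrite sqrf_eq0 gt_eqF ?dist2_gt0.
    by apply: continuous_mulfun; exact: continuous_dist2.
  + move=> xi /dE h; have D1 := dist2_gt0 xi.
    rewrite ler_pdivlMr ?exprn_gt0//.
    have -> : 2^-1 / dist2 xi * dist2 xi ^+ 2 = dist2 xi / 2 by field; rewrite gt_eqF.
    have : 0 <= r ^+ 2 * dist2 xi by rewrite mulr_ge0 ?sqr_ge0// ltW.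
    lra.
Qed.
End LowerBound.

(** * Lower bounds for integrals by step functions *)

(** Both integrals are suprema over the simple functions below the integrand, so
    f2 may be any function. *)
Lemma ge0_le_integral_nomeas d (T : measurableType d) (R : realType)
    (mu : {measure set T -> \bar R}) (f1 f2 : T -> \bar R) :
  (forall x, (0 <= f1 x)%E) -> (forall x, (f1 x <= f2 x)%E) ->
  (\int[mu]_x f1 x <= \int[mu]_x f2 x)%E.
Proof.
move=> f10 f12; have f20 x : (0 <= f2 x)%E by exact: le_trans (f12 x).
rewrite !ge0_integralTE//; apply: ereal_sup_le => _ [h hf1 <-].
by exists h => // x; exact: le_trans (f12 x).
Qed.

Lemma integral_ge_step d (T : measurableType d) (R : realType)
    (mu : {measure set T -> \bar R}) (f : T -> \bar R) (F : nat -> set T) (c : nat -> R) (K : nat) :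
  (forall x, (0 <= f x)%E) -> (forall k, measurable (F k)) -> trivIset setT F ->
  (forall k, 0 <= c k) -> (forall k x, (k < K)%N -> F k x -> ((c k)%:E <= f x)%E) ->
  (\sum_(0 <= k < K) (c k)%:E * mu (F k) <= \int[mu]_x f x)%E.
Proof.
move=> f0 mF tF c0 cf.
have mI k : measurable_fun setT (fun x => (\1_(F k) x)%:E : \bar R).
  by apply/measurable_EFinP; exact: measurable_indic.
have -> : (\sum_(0 <= k < K) (c k)%:E * mu (F k) =
    \int[mu]_x (\sum_(0 <= k < K) (c k)%:E * (\1_(F k) x)%:E))%E.
  rewrite ge0_integral_sum//; last 2 first.
  - by move=> k; apply: measurable_funeM; exact: mI.
  - by move=> k x _; rewrite mule_ge0 ?lee_fin.
  apply: eq_bigr => k _; rewrite ge0_integralZl ?lee_fin//.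
  - by rewrite integral_indic// setIT.
apply: ge0_le_integral_nomeas => x.
  by apply: sume_ge0 => k _; rewrite mule_ge0 ?lee_fin.
have [[k [kK Fkx]]|nF] := pselect (exists k, (k < K)%N /\ F k x).
  rewrite (bigD1_seq k)/= ?mem_index_iota ?iota_uniq//.
  rewrite big1 ?adde0; last first.
    move=> j jk; rewrite indicE memNset ?mule0// => Fjx.
    have /trivIsetP/(_ j k I I jk) := tF.
    by move/seteqP => [+ _] => /(_ x); apply.
  by rewrite indicE mem_set// mule1; exact: cf.
rewrite big_nat big1// => k /andP[_ kK]; rewrite indicE memNset ?mule0// => Fkx.
by apply: nF; exists k.
Qed.

(** * Failure of the Hardy condition *)

Section NotHardy.
Variables (R : realType) (s : R).
Hypotheses (s_gt0 : 0 < s) (s_lt1 : s < 1).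
Variable g : nat -> R.
Hypothesis g_gt0 : forall n, 0 < g n.
Hypothesis g_decr : {homo g : m n / (m <= n)%N >-> n <= m}.
Hypothesis g_sum : series (fun n => 2 ^+ n * g n) @ \oo --> (1 : R).
Variable C : R.
Hypothesis C_gt0 : 0 < C.
Hypothesis g_tail : forall n N,
  \sum_(n <= m < N) 2 ^+ m * g m <= C * (2 ^+ n * g n).

Local Notation T := (jump g).
Local Notation Tl := (jump_left g).
Local Notation N := (@Normc.normc R).
Implicit Types (k n : nat) (xi zeta : circle R) (t x : R).

Let w_gt0 k : 0 < node_gap g k. Proof. exact: g_gt0. Qed.
Let Tl_ge0 k : 0 <= Tl (dyad R k). Proof. exact: jump_left_ge0 g_gt0 g_sum _. Qed.
Let T_le1 k : T (dyad R k) <= 1. Proof. exact: jump_le1 g_gt0 g_sum _. Qed.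
Let TE k : T (dyad R k) = Tl (dyad R k) + node_gap g k.
Proof. exact: jump_dyad g_gt0 g_sum _. Qed.

(** The middle half of a gap: its points stay away from the Cantor set by a quarter
    of the gap. *)
Definition mid_arc k : set (circle R) :=
  circ_arc (Tl (dyad R k) + node_gap g k / 4) (T (dyad R k) - node_gap g k / 4).

Lemma measurable_mid_arc k : measurable (mid_arc k).
Proof.
have := w_gt0 k; have := Tl_ge0 k; have := T_le1 k => h1 h2 h3.
by apply: measurable_arc; lra.
Qed.

Lemma arclength_mid_arc k : arclength (mid_arc k) = (node_gap g k / 2)%:E.
Proof.
have := w_gt0 k; have := Tl_ge0 k; have := T_le1 k; have := TE k => h0 h1 h2 h3.
rewrite arclength_arc; [congr (_%:E)|..]; lra.
Qed.

Lemma mid_arc_sub k : mid_arc k `<=` gap_arc g k.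
Proof.
move=> _ [t /= + <-]; rewrite in_itv/= => /andP[h1 h2]; exists t => //=.
by rewrite in_itv/=; have := w_gt0 k; lra.
Qed.

Lemma trivIset_mid_arc : trivIset setT mid_arc.
Proof.
apply/trivIsetP => j k _ _ jk; have /trivIsetP/(_ j k I I jk) := trivIset_gap_arc g_gt0 g_sum.
rewrite -!subset0 => h xi [/mid_arc_sub h1 /mid_arc_sub h2].
exact: (h xi).
Qed.

Lemma chord2_cantor_ge k zeta xi (h : R) : 0 < h -> h <= node_gap g k / 4 ->
  mid_arc k zeta -> cantor_set g xi -> 2 - 2 * cos (2 * pi * h) <= chord2 xi zeta.
Proof.
move=> h0 hw [t /= + <-]; rewrite in_itv/= => /andP[t1 t2] nxi.
have [x /andP[x0 x1] xE] := circle_exp_surj xi; rewrite -xE in nxi *.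
have xk : ~ (Tl (dyad R k) < x < T (dyad R k)).
  move=> hx; apply: nxi; exists k => //; apply/arcE => //.
  by rewrite x0.
have := w_gt0 k; have := Tl_ge0 k; have := T_le1 k; have := TE k => h1 h2 h3 h4.
have [xa|xa] := leP x (Tl (dyad R k)).
  by apply: chord2_ge => //; rewrite ler0_norm; lra.
have xb : T (dyad R k) <= x by rewrite leNgt; apply/negP => xb; apply: xk; rewrite xa.
by apply: chord2_ge => //; rewrite ger0_norm; lra.
Qed.

Lemma chord2_cell_le k zeta xi : mid_arc k zeta -> cell_arc g k xi ->
  chord2 xi zeta <= 4 * pi ^+ 2 * (C * node_gap g k) ^+ 2.
Proof.
move=> [t /= + <-]; rewrite in_itv/= => /andP[t1 t2] [x /= + <-].
rewrite in_itv/= => /andP[x1 x2].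
apply: (le_trans (chord2_le _ _)).
rewrite ler_wpM2l ?(mulr_ge0 _ (sqr_ge0 _))//.
have [h1 h2] := gap_in_cell g_gt0 g_sum k.
have h3 := jump_cell g_gt0 g_sum g_tail k; have h4 := w_gt0 k.
rewrite -(real_normK (num_real (x - t))) ler_pXn2r ?nnegrE ?mulr_ge0 ?(ltW h4) ?(ltW C_gt0)//.
by rewrite ler_norml; apply/andP; split; lra.
Qed.

Variable nu : {finite_measure set (circle R) -> \bar R}.
Hypothesis nu_gt0 : (0 < nu setT)%E.
Hypothesis nu_le1 : (nu setT <= 1)%E.
Hypothesis nu_null : nu (~` cantor_set g) = 0%E.
Hypothesis nu_cell : forall k, (nu (cell_arc g k) <= ((2 ^+ lev k)^-1)%:E)%E.
Hypothesis nu_cover : forall n, nu (~` level_cover g n) = 0%E.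

Let nuE (A : set (circle R)) : measurable A -> nu A = (fine (nu A))%:E.
Proof. by move=> mA; rewrite fineK// fin_num_measure. Qed.

Definition cell_mass k : R := fine (nu (cell_arc g k)).

Let cell_mass_ge0 k : 0 <= cell_mass k. Proof. exact: fine_ge0. Qed.

Let cell_massE k : nu (cell_arc g k) = (cell_mass k)%:E.
Proof. by apply: nuE; exact: measurable_cell_arc. Qed.

Lemma cell_mass_sum n :
  fine (nu setT) <= \sum_((2 ^ n).-1 <= k < (2 ^ n.+1).-1) cell_mass k.
Proof.
rewrite -lee_fin -nuE//; apply: le_trans (level_cover_le measurableT (nu_cover n)) _.
rewrite -sumEFin le_eqVlt; apply/orP; left; apply/eqP.
by apply: eq_bigr => k _; rewrite setTI; exact: cell_massE.
Qed.

(** On the interval from 0 to M the concave power x ^ s is at least x * M ^ (s - 1);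
    here M = 2 ^ - lev k. *)
Lemma cell_mass_powR k : cell_mass k * (2 ^+ lev k) `^ (1 - s) <= cell_mass k `^ s.
Proof.
have := nu_cell k; rewrite cell_massE lee_fin => h.
have e0 : 0 < (2 : R) ^+ lev k by rewrite exprn_gt0.
have := cell_mass_ge0 k; rewrite le_eqVlt => /predU1P[<-|p0].
  by rewrite mul0r powR_ge0.
have pE : cell_mass k = cell_mass k `^ (s + (1 - s)).
  by rewrite addrC subrK powRr1// ltW.
rewrite {1}pE powRD; last by rewrite (gt_eqF p0) implybT.
rewrite -mulrA ger_pMr ?powR_gt0// -powRM ?(ltW p0) ?(ltW e0)//.
have p1 : 1 `^ (1 - s) = 1 :> R by rewrite powR1.
rewrite -[leRHS]p1 ge0_ler_powR ?nnegrE ?mulr_ge0 ?(ltW p0) ?(ltW e0)//.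
  by rewrite subr_ge0 ltW.
by rewrite -ler_pdivlMr// mul1r.
Qed.

(** The term 1 is for (1 - r) ^ 2, which is at most the squared gap, and the
    other one for the chords, which are at most 2 pi times the arcs. *)
Definition dist_const : R := 1 + 4 * pi ^+ 2 * C ^+ 2.

Lemma dist_const_gt0 : 0 < dist_const.
Proof. by rewrite /dist_const ltr_wpDr// mulr_ge0 ?sqr_ge0// mulr_ge0 ?sqr_ge0. Qed.

(** Only finitely many gaps come in, so that a single radius close to 1 serves
    all of them. *)
Lemma exists_radius n : exists r : R, 0 < r < 1 /\
  forall k zeta, (k < (2 ^ n).-1)%N -> mid_arc k zeta ->
  expR (-1) * ((2 * (dist_const * node_gap g k ^+ 2))^-1 * cell_mass k) <=
  N (derive1 (singular_inner nu) (r%:C * circle_val zeta)).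
Proof.
(* gam is smaller than the gaps that come in, eta is below the squared chord
   from their middle halves to the Cantor set, and e = 1 - r is small compared
   with both *)
pose gam := g n; have gam0 : 0 < gam by exact: g_gt0.
have gam1 : gam <= 1.
  have -> : gam = node_gap g (2 ^ n).-1.
    by rewrite /node_gap (lev_eq (n := n))// prednK ?expn_gt0// leqnn ltn_exp2l /=.
  by have := TE (2 ^ n).-1; have := Tl_ge0 (2 ^ n).-1; have := T_le1 (2 ^ n).-1; lra.
pose eta : R := 2 - 2 * cos (2 * pi * (gam / 4)).
have eta0 : 0 < eta by apply: chord2_min_gt0; lra.
pose e := Num.min (1 / 2) (Num.min (eta / 8) gam).
have e0 : 0 < e by rewrite !lt_min gam0 !divr_gt0.
have [e1 [e2 e3]] : e <= 1 / 2 /\ e <= eta / 8 /\ e <= gam.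
  by rewrite /e !ge_min !lexx !orbT.
exists (1 - e); split; first lra.
move=> k zeta kn zk.
have gw : gam <= node_gap g k.
  by apply: g_decr; rewrite ltnW// lev_lt.
have m1 : fine (nu setT) <= 1 by rewrite -lee_fin -nuE.
have m0 : 0 <= fine (nu setT) by exact: fine_ge0.
have w0 := w_gt0 k.
apply: (@derive1_lower_bound _ _ zeta (1 - e) _ _ (cantor_set g) _ (eta / 2)).
- lra.
- lra.
- by apply: closed_measurable_circle; exact: closed_cantor_set g_gt0 g_sum.
- by [].
- lra.
- move=> xi Exi; rewrite /dist2.
  have := @chord2_cantor_ge k zeta xi (gam / 4) _ _ zk Exi; rewrite -/eta => h.
  have {}h : eta <= chord2 xi zeta by apply: h; lra.
  have := sqr_ge0 (1 - (1 - e)); nra.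
- nra.
- have : (1 - (1 - e) ^+ 2) <= 2 * e by nra.
  have : 0 <= 1 - (1 - e) ^+ 2 by nra.
  nra.
- exact: measurable_cell_arc.
- move=> xi /(chord2_cell_le zk) h; rewrite /dist2 /dist_const.
  have c0 : 0 <= chord2 xi zeta by rewrite addr_ge0 ?sqr_ge0.
  apply: (@le_trans _ _ (e ^+ 2 + chord2 xi zeta)).
    rewrite (_ : 1 - (1 - e) = e) ?lerD2l; last by ring.
    rewrite ler_piMl//; lra.
  rewrite mulrDl mul1r lerD//; first by rewrite ler_pXn2r ?nnegrE//; lra.
  by rewrite -mulrA -exprMn.
- by rewrite mulr_gt0 ?dist_const_gt0// exprn_gt0.
Qed.

Hypothesis g_diverges : forall K : R, exists n, K <= \sum_(0 <= i < n)
        g i `^ (1 - 2 * s) * (2 ^+ i) `^ (1 - s).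

(** On the middle half of gap k the derivative is at least a constant times
    cell_mass k / (node_gap k) ^ 2. Taking the power s, integrating over that arc and
    using cell_mass_powR, generation i contributes at least a constant times
    g i ^ (1 - 2 s) * (2 ^ i) ^ (1 - s) times the total mass of nu, whatever the
    distribution of this mass among the cells. *)
Lemma derive1_not_hardy : ~ hardy s (derive1 (singular_inner nu)).
Proof.
move=> [_ sup_lt].
set S := [set _ | _ in _] in sup_lt.
pose B : R := (expR (-1) / (2 * dist_const)) `^ s / 2.
have A0 := dist_const_gt0.
have B0 : 0 < B.
  by rewrite divr_gt0// powR_gt0// divr_gt0 ?expR_gt0// mulr_gt0.
have m0 : 0 < fine (nu setT) by rewrite -lte_fin -nuE.
have low n : ((B * fine (nu setT) * \sum_(0 <= i < n) g i `^ (1 - 2 * s) * (2 ^+ i) `^ (1 - s))%:E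
    <= ereal_sup S)%E.
  have [r [r01 rP]] := exists_radius n.
  apply: (@le_trans _ _ (\int[@arclength R]_xi
     (N (derive1 (singular_inner nu) (r%:C * circle_val xi)) `^ s)%:E)%E); last first.
    by apply: ereal_sup_ubound; exists r.
  pose c k := (expR (-1) * ((2 * (dist_const * node_gap g k ^+ 2))^-1 * cell_mass k)) `^ s.
  have y0 k : 0 <= expR (-1) * ((2 * (dist_const * node_gap g k ^+ 2))^-1 * cell_mass k).
    by rewrite !mulr_ge0 ?expR_ge0// invr_ge0 !mulr_ge0 ?sqr_ge0// ltW.
  apply: le_trans (@integral_ge_step _ _ _ _ _ mid_arc c (2 ^ n).-1 _ _ _ _ _).
  - rewrite (eq_bigr (fun k => (c k * (node_gap g k / 2))%:E)); last first.
      by move=> k _; rewrite EFinM; congr (_ * _)%E; exact: arclength_mid_arc.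
    rewrite sumEFin lee_fin sum_blocks mulr_sumr; apply: ler_sum => i _.
    apply: (@le_trans _ _ (\sum_((2 ^ i).-1 <= k < (2 ^ i.+1).-1)
       B * (g i `^ (1 - 2 * s) * (2 ^+ i) `^ (1 - s)) * cell_mass k)).
      rewrite -mulr_sumr [X in X <= _]mulrAC ler_wpM2l ?cell_mass_sum//.
      by rewrite !mulr_ge0 ?powR_ge0// ltW.
    apply: ler_sum_nat => k; rewrite lev_block => /eqP ki.
    have -> : c k * (node_gap g k / 2) = B * (g i `^ (1 - 2 * s) * cell_mass k `^ s).
      have gi0 := g_gt0 i.
      rewrite /c /node_gap ki.
      have -> : expR (-1) * ((2 * (dist_const * g i ^+ 2))^-1 * cell_mass k) =
        (expR (-1) / (2 * dist_const)) * (g i `^ (- 2) * cell_mass k).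
        rewrite powRN powR_mulrn ?(ltW gi0)//; field.
        by rewrite !gt_eqF.
      have a0 : 0 <= expR (-1) / (2 * dist_const).
        by rewrite divr_ge0 ?expR_ge0// mulr_ge0// ltW.
      rewrite /B; move: (expR (-1) / (2 * dist_const)) a0 => a a0.
      rewrite powRM// ?mulr_ge0 ?powR_ge0// powRM ?powR_ge0//.
      rewrite -powRrM (_ : 1 - 2 * s = - 2 * s + 1); last by ring.
      by rewrite powRD ?(gt_eqF gi0) ?implybT// powRr1 ?(ltW gi0)//; ring.
    rewrite -mulrA ler_wpM2l ?(ltW B0)// -mulrA ler_wpM2l ?powR_ge0//.
    by rewrite mulrC -ki cell_mass_powR.
  - by move=> xi; rewrite lee_fin powR_ge0.
  - exact: measurable_mid_arc.
  - exact: trivIset_mid_arc.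
  - by move=> k; exact: powR_ge0.
  - move=> k xi kn xik; rewrite lee_fin ge0_ler_powR ?nnegrE ?normc_ge0 ?y0 ?(ltW s_gt0)//.
    exact: rP.
have [V VS] : exists V : R, (ereal_sup S <= V%:E)%E.
  case: (ereal_sup S) sup_lt => [v _|//|_]; first by exists v.
  by exists 0; exact: leNye.
have [n] := g_diverges ((V + 1) / (B * fine (nu setT))).
have Bm0 : 0 < B * fine (nu setT) by exact: mulr_gt0.
rewrite ler_pdivrMr// [leRHS]mulrC => h.
have := le_trans (low n) VS; rewrite lee_fin leNgt => /negP; apply.
by apply: lt_le_trans h; rewrite ltrDl.
Qed.
End NotHardy.

Theorem corollary4p1 (R : realType) (s : R) (s_gt0 : 0 < s) (s_lt : s < 1 / 2) :
  let q := s / (1 - s) in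
  let theta := 1 - q in
  exists (E : set (circle R)) (mu : probability (circle R) R),
    [/\ closed E, arclength E = 0%E &
    [/\ nonatomic mu, singular mu & mu (~` E) = 0%E] /\
    [/\ (\esum_(J in components (~` E))
           (let l := fine (arclength J) in
            l `^ theta * ln (expR 1 / l) `^ q)%:E < +oo)%E &
        forall nu : {finite_measure set (circle R) -> \bar R},
          (0 < nu [set: circle R])%E ->
          (forall A, measurable A -> (nu A <= mu A)%E) ->
          ~ hardy s (derive1 (singular_inner nu))]].
Proof.
move=> q theta.
have [g [[g0 gd gs [C C0 gt]] [[M gM] gK]]] := exists_gap_lengths s_gt0 s_lt.
have [mu [mu0 muc muU]] := exists_cantor_measure g0 gs.
have mE : measurable (cantor_set g).
  by apply: closed_measurable_circle; exact: closed_cantor_set.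
exists (cantor_set g), mu; split; [exact: closed_cantor_set|exact: arclength_cantor_set|].
split; first split => //.
- by apply: (@nonatomic_of_small_cells R g).
- by exists (cantor_set g); split => //; exact: arclength_cantor_set.
split.
  apply: (@le_lt_trans _ _ M%:E); last exact: ltry.
  apply: (@esum_components R g g0 gs (fun l => l `^ theta * ln (expR 1 / l) `^ q)) => //.
  by move=> x; rewrite mulr_ge0 ?powR_ge0.
move=> nu nu_gt0 nu_mu.
have s1 : s < 1 by lra.
apply: (@derive1_not_hardy R s s_gt0 s1 g g0 gd gs C C0 gt) => //.
- by rewrite -(probability_setT mu); exact: nu_mu.
- apply/eqP; rewrite -measure_le0 -mu0; apply: nu_mu; exact: measurableC.
- by move=> k; apply: (le_trans (nu_mu _ _)) => //; exact: measurable_cell_arc.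
- move=> n; apply/eqP; rewrite -measure_le0 -(muU n); apply: nu_mu.
  by apply: measurableC; exact: measurable_level_cover.
Qed.
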